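(* Let $\Omega\subset\mathbb{R}^N$, $N\geq 1$, be open, let $\mathcal{H}$ be an admissible Hilbert space of vector fields on $\Omega$ with associated group $G_{\mathcal{H}}$ and distance $d_{\mathcal{H}}$, let $I_0,I_1\in L^2(\Omega)$, and let $\alpha,\beta,\gamma>0$. Let $\lambda_n>0$ and $a_n\geq 0$, $n\in\mathbb{N}=\{0,1,2,\dots\}$, satisfy $$a_n\leq a_{n-1}\ \text{for any }n\geq 1,\qquad \lim_n a_n=0,\qquad\limsup_n\frac{2^{\beta n}}{\lambda_n}<+\infty.$$ Let $\{g_n\}_{n\in\mathbb{N}}\subset G_{\mathcal{H}}$ be any sequence such that $g_0$ is a minimizer over $g\in G_{\mathcal{H}}$ of $$\lambda_0\left[\|I_0\circ g^{-1}-I_1\|_{L^2(\Omega)}^{\alpha}+a_0d_{\mathcal{H}}(g,e)^{\gamma}\right]+d_{\mathcal{H}}(g,e)^{\beta}$$ and, for $n\geq 1$, $g_n$ is a minimizer over $g\in G_{\mathcal{H}}$ of $$\lambda_n\left[\|I_0\circ\tilde{g}_{n-1}^{-1}\circ g^{-1}-I_1\|_{L^2(\Omega)}^{\alpha}+a_nd_{\mathcal{H}}(g\circ\tilde{g}_{n-1},e)^{\gamma}\right]+d_{\mathcal{H}}(g,e)^{\beta},$$ where $\tilde{g}_n=g_n\circ\cdots\circ g_0$. Let $\delta_0=\inf\{\|I_0\circ g^{-1}-I_1\|_{L^2(\Omega)}:\ g\in G_{\mathcal{H}}\}$ and $$\varepsilon_0=\lim_n\left(\|I_0\circ\tilde{g}_n^{-1}-I_1\|_{L^2(\Omega)}^{\alpha}+a_nd_{\mathcal{H}}(\tilde{g}_n,e)^{\gamma}\right)^{1/\alpha}$$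 (the limit exists, the sequence being nonincreasing). Then $\varepsilon_0=\delta_0$ and $$\lim_n\|I_0\circ\tilde{g}_n^{-1}-I_1\|_{L^2(\Omega)}=\delta_0.$$
   Context: A Hilbert space $\mathcal{H}$ of vector fields on $\Omega$ is admissible if it is contained and continuously embedded in $C^1_0(\Omega,\mathbb{R}^N)$, the space of $C^1$ vector fields $u$ on $\Omega$ such that $u$ and $Du$ vanish on $\partial\Omega$ and at infinity. $L^2([0,1],\mathcal{H})$ is the Hilbert space of time-dependent vector fields with scalar product $\int_0^1\langle u(t),v(t)\rangle_{\mathcal{H}}\,dt$ and norm $\|\cdot\|$. For $u\in L^2([0,1],\mathcal{H})$, $\varphi^u$ is the flow solving $\partial_t\varphi=u\circ\varphi$, $\varphi(0)=e$, with $e$ the identity map; each $\varphi^u(t)$ is a $C^1$ diffeomorphism of $\Omega$ onto itself (extended by the identity outside $\Omega$). Set $$G_{\mathcal{H}}=\{\varphi^u(1):\ u\in L^2([0,1],\mathcal{H})\},\qquad d_{\mathcal{H}}(g_0,g_1)=\min\{\|u\|:\ u\in L^2([0,1],\mathcal{H}),\ g_1=g_0\circ\varphi^u(1)\}.$$ $G_{\mathcal{H}}$ is a group under composition and a complete metric space with the left-invariant distance $d_{\mathcal{H}}$. Sequences of minimizers as in the claim exist (not necessarily unique). *)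

(* Defs.v *)
From HB Require Import structures.
From mathcomp Require Import all_boot all_order all_algebra.
From mathcomp Require Import all_classical all_reals all_analysis.

Set Implicit Arguments.
Unset Strict Implicit.
Unset Printing Implicit Defensive.

Import Order.TTheory GRing.Theory Num.Theory.
Import numFieldNormedType.Exports.

Local Open Scope classical_set_scope.
Local Open Scope ring_scope.

(* R^N is 'rV[R]_N, whose library norm is the sup norm. It is used only in
   topological notions and in a boundedness condition up to a constant, so it
   can be replaced by the Euclidean norm. *)

(* The sigma-algebra of R^N is the one generated by the coordinate maps (as the
   library does for n.-tuple T), i.e., the Borel sigma-algebra. *)
Section measurable_rV.
Context {R : realType} (n : nat).

Let coors : 'I_n -> 'rV[R]_n -> R := fun i x => x ord0 i.

Let rV_set0 : g_sigma_preimage coors set0.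
Proof. exact: sigma_algebra0. Qed.

Let rV_setC A : g_sigma_preimage coors A -> g_sigma_preimage coors (~` A).
Proof. exact: sigma_algebraC. Qed.

Let rV_bigcup (F : (set 'rV[R]_n)^nat) :
  (forall i, g_sigma_preimage coors (F i)) ->
  g_sigma_preimage coors (\bigcup_i (F i)).
Proof. exact: sigma_algebra_bigcup. Qed.

HB.instance Definition _ := @isMeasurable.Build default_measure_display
  'rV[R]_n (g_sigma_preimage coors) rV_set0 rV_setC rV_bigcup.

Lemma measurable_coord (i : 'I_n) :
  measurable_fun [set: 'rV[R]_n] (fun x : 'rV[R]_n => x ord0 i).
Proof.
move=> _ Y mY; rewrite setTI; apply: sub_sigma_algebra => /=.
rewrite -bigcup_seq/=; exists i => /=; first by rewrite mem_index_enum.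
by exists Y => //; rewrite setTI.
Qed.

Lemma measurable_fun_rVP d (T : measurableType d) (f : T -> 'rV[R]_n) :
  (forall i, measurable_fun [set: T] (fun t => f t ord0 i)) ->
  measurable_fun [set: T] f.
Proof.
move=> mf; have sub : g_sigma_preimage (fun i => coors i \o f) `<=` measurable.
  apply: smallest_sub; first exact: sigma_algebra_measurable.
  by rewrite -bigcup_seq; apply: bigcup_sub => i _ A [B mB <-]; exact: mf.
rewrite g_sigma_preimage_comp in sub.
by move=> _ A mA; apply: sub; exists A.
Qed.

End measurable_rV.

Section lebesgue_rV.
Context {R : realType}.

(* 'rV_n.+1 is convertible to 'rV_(1 + n) *)
Definition cons_rV n (p : R * 'rV[R]_n) : 'rV[R]_n.+1 :=
  (row_mx (p.1%:M : 'rV[R]_1) p.2 : 'rV[R]_(1 + n)).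

Lemma measurable_cons_rV n : measurable_fun setT (@cons_rV n).
Proof.
apply: measurable_fun_rVP => i; rewrite /cons_rV.
case: (@split_ordP 1 n i) => j ->.
  rewrite (_ : (fun _ => _) = fst); first exact: measurable_fst.
  by apply/funext => t; rewrite (@row_mxEl _ 1 1 n) mxE !ord1 mulr1n.
under eq_fun do rewrite (@row_mxEr _ 1 1 n).
apply: (measurableT_comp (measurable_coord j)); exact: measurable_snd.
Qed.

Definition lebesgue_step n (mu : {measure set 'rV[R]_n -> \bar R}) :=
  pushforward (lebesgue_measure \x^ mu)%E (@cons_rV n).

Section lebesgue_step_measure.
Variables (n : nat) (mu : {measure set 'rV[R]_n -> \bar R}).

Let lebesgue_step0 : lebesgue_step mu set0 = 0%E.
Proof. by rewrite /lebesgue_step /pushforward preimage_set0 measure0. Qed.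

Let lebesgue_step_ge0 A : (0 <= lebesgue_step mu A)%E.
Proof. by rewrite /lebesgue_step /pushforward measure_ge0. Qed.

Let lebesgue_step_sigma_additive : semi_sigma_additive (lebesgue_step mu).
Proof.
exact: (@measure_semi_sigma_additive _ _ _
  (measure_function_pushforward__canonical__measure_function_Measure
    (lebesgue_measure \x^ mu)%E (@measurable_cons_rV n))).
Qed.

HB.instance Definition _ := isMeasure.Build _ _ _ (lebesgue_step mu)
  lebesgue_step0 lebesgue_step_ge0 lebesgue_step_sigma_additive.

End lebesgue_step_measure.

(* N-dimensional Lebesgue measure, as the N-fold product of the
   one-dimensional one. *)
Fixpoint lebesgue_rV n : {measure set 'rV[R]_n -> \bar R} :=
  match n with
  | 0 => dirac (0 : 'rV[R]_0)
  | m.+1 => lebesgue_step (lebesgue_rV m)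
  end.

Lemma lebesgue_rV_box n (a b : 'rV[R]_n) : (forall i, a ord0 i <= b ord0 i) ->
  lebesgue_rV n [set x : 'rV[R]_n | forall i, a ord0 i <= x ord0 i <= b ord0 i] =
  (\prod_(i < n) (b ord0 i - a ord0 i))%:E.
Proof.
elim: n => [|n IH] in a b *.
  by move=> _; rewrite /= diracE big_ord0 mem_set//= => -[].
move=> ab.
pose t (c : 'rV[R]_n.+1) : 'rV[R]_n := \row_j c ord0 (lift ord0 j).
transitivity (lebesgue_rV n.+1
    [set x | a ord0 ord0 <= x ord0 ord0 <= b ord0 ord0 /\
             forall j, a ord0 (lift ord0 j) <= x ord0 (lift ord0 j)
                       <= b ord0 (lift ord0 j)]).
  congr (lebesgue_rV _ _); apply/seteqP; split=> x /= => [h|[h0 h] i] //.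
  by case: (unliftP ord0 i) => [j ->|->].
rewrite /= /lebesgue_step /pushforward.
transitivity ((lebesgue_measure \x^ lebesgue_rV n)%E
    (`[a ord0 ord0, b ord0 ord0]%classic `*`
     [set x : 'rV[R]_n | forall i, t a ord0 i <= x ord0 i <= t b ord0 i])).
  congr (product_measure2 _ _ _); apply/seteqP.
  have l0 : (ord0 : 'I_n.+1) = lshift n (ord0 : 'I_1) by exact: val_inj.
  have lj j : lift (ord0 : 'I_n.+1) j = rshift 1 j by exact: val_inj.
  have e0 (p : R * 'rV[R]_n) : cons_rV p ord0 ord0 = p.1.
    by rewrite l0 /cons_rV (@row_mxEl _ 1 1 n) mxE eqxx mulr1n.
  have ej (p : R * 'rV[R]_n) j : cons_rV p ord0 (lift ord0 j) = p.2 ord0 j.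
    by rewrite lj /cons_rV (@row_mxEr _ 1 1 n).
  split=> p /= [h0 h]; split.
  - by move: h0; rewrite e0 in_itv.
  - by move=> j; have := h j; rewrite ej !mxE.
  - by move: h0; rewrite e0 in_itv.
  - by move=> j; have := h j; rewrite ej !mxE.
rewrite product_measure2E//; last first.
  rewrite (_ : mkset _ = \bigcap_(i : 'I_n)
      ((fun x : 'rV[R]_n => x ord0 i) @^-1` `[t a ord0 i, t b ord0 i])); last first.
    apply/seteqP; split=> x /= h i; first by move=> _; rewrite /= in_itv; exact: h.
    by have /= := h i Logic.I; rewrite in_itv.
  apply: fin_bigcap_measurable => // i _.
  by rewrite -[X in measurable X]setTI; exact: measurable_coord.
rewrite IH; last by move=> i; rewrite !mxE.
rewrite /= lebesgue_measure_itv/= lte_fin big_ord_recl EFinM; congr (_ * _)%E.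
  have := ab ord0; rewrite le_eqVlt => /predU1P[->|->]; last by rewrite -EFinD.
  by rewrite ltxx subrr.
by congr (_%:E); apply: eq_bigr => i _; rewrite !mxE.
Qed.

End lebesgue_rV.

Section images.
Context {R : realType} {N : nat}.
Implicit Types (Omega : set 'rV[R]_N) (f : 'rV[R]_N -> R).

(* Elements of L^2(Omega) are given by representatives; values outside of Omega
   are irrelevant. *)
Definition inL2 Omega f := (f \_ Omega) \in Lfun (lebesgue_rV N) 2%:E.

(* fine only discards the value +oo, which does not occur on L^2(Omega); note
   that I \o g^-1 stays in L^2(Omega) for the bi-Lipschitz maps g of groupH *)
Definition L2norm Omega f : R :=
  fine ('N[lebesgue_rV N]_2%:E [EFin \o (f \_ Omega)])%E.

End images.

Section vector_fields.
Context {R : realType} {N : nat}.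
Local Notation V := 'rV[R]_N.
Implicit Types (Omega : set V) (u : V -> V).

Definition vanishes_at_boundary (W : normedModType R) Omega (F : V -> W) :=
  forall p, closure Omega p -> ~ Omega p ->
    F x @[x --> within Omega (nbhs p)] --> (0 : W).

Definition vanishes_at_infinity (W : normedModType R) Omega (F : V -> W) :=
  forall e : R, 0 < e ->
    exists M : R, forall x, Omega x -> M < `|x| -> `|F x| < e.

(* C^1_0(Omega, R^N), for Omega open. A vector field on Omega is represented by
   its extension by zero to R^N. *)
Record C10 Omega u : Prop := {
  C10_outside : forall x, ~ Omega x -> u x = 0;
  C10_differentiable : forall x, Omega x -> differentiable u x;
  C10_continuous : forall x, Omega x -> {for x, continuous (jacobian u)};
  C10_boundary : vanishes_at_boundary Omega u;
  C10_jacobian_boundary : vanishes_at_boundary Omega (jacobian u);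
  C10_infinity : vanishes_at_infinity Omega u;
  C10_jacobian_infinity : vanishes_at_infinity Omega (jacobian u) }.

(* A Hilbert space of vector fields is an abstract complete normed space H whose
   norm comes from the scalar product dot, together with the injection ev of H
   into the space of vector fields. The last clause is the continuity of ev for
   the C^1 norm sup_Omega |u| + sup_Omega |Du| of C^1_0(Omega, R^N). *)
Record admissible Omega (H : completeNormedModType R)
    (dot : {dot H for idfun}) (ev : {linear H -> (V -> V)}) : Prop := {
  admissible_norm : forall h, `|h| ^+ 2 = dot h h;
  admissible_inj : injective ev;
  admissible_C10 : forall h, C10 Omega (ev h);
  admissible_embedding : exists C : R, forall h x y, Omega x -> Omega y ->
    `|ev h x| + `|jacobian (ev h) y| <= C * `|h| }.

End vector_fields.

Section flows.
Context {R : realType} {N : nat} {H : completeNormedModType R}.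
Local Notation V := 'rV[R]_N.
Local Notation I01 := (`[0%R, 1%R]%classic : set R).
Local Notation leb := (@lebesgue_measure R).
Variable ev : {linear H -> (V -> V)}.
Implicit Types (u : R -> H) (phi : R -> V -> V).

Definition simple_fun (s : R -> H) :=
  finite_set (range s) /\ forall h, measurable (s @^-1` [set h]).

(* Bochner measurability, for a representative *)
Definition strongly_measurable u :=
  exists s : nat -> R -> H, (forall n, simple_fun (s n)) /\
    forall t, I01 t -> s n t @[n --> \oo] --> u t.

(* u is (a representative of) an element of L^2([0,1], H) *)
Definition L2H u := strongly_measurable u /\
  (\int[leb]_(t in I01) (`|u t| ^+ 2)%:E < +oo)%E.

Definition L2H_norm u : R := Num.sqrt (\int[leb]_(t in I01) (`|u t| ^+ 2)).

(* d/dt phi = u o phi, phi(0) = e on [0,1]; as u is only square integrable in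
   time this is understood in the integral (Caratheodory) sense. Because vector
   fields are extended by zero, the flow is the identity outside of Omega. *)
Definition is_flow u phi := forall x : V,
  {within I01, continuous (phi ^~ x)} /\
  forall t, I01 t -> forall i,
    phi t x ord0 i =
      x ord0 i + \int[leb]_(s in `[0%R, t]) (ev (u s) (phi s x) ord0 i).

Definition groupH : set (V -> V) :=
  [set g | exists u phi, [/\ L2H u, is_flow u phi & g = phi 1]].

(* the infimum is attained when g0 and g1 belong to groupH *)
Definition distH (g0 g1 : V -> V) : R :=
  inf [set r | exists u phi,
    [/\ L2H u, is_flow u phi, g1 = g0 \o phi 1 & r = L2H_norm u]].

End flows.

Definition minimizer_over {R : realType} {T : Type} (G : set T) (J : T -> R)
    (g : T) := G g /\ forall h, G h -> J g <= J h.

(* inverse of a bijection of R^N *)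
Definition invmap {R : realType} {N : nat} (g : 'rV[R]_N -> 'rV[R]_N) :
  'rV[R]_N -> 'rV[R]_N := pinv setT g.

(* composed g n = g n \o ... \o g 0 *)
Fixpoint composed {T : Type} (g : nat -> T -> T) (n : nat) : T -> T :=
  match n with
  | 0 => g 0%N
  | m.+1 => g m.+1 \o composed g m
  end.

(* Main.v *)
Require Import Defs.
From HB Require Import structures.
From mathcomp Require Import all_boot all_order all_algebra.
From mathcomp Require Import all_classical all_reals all_analysis.
From mathcomp Require Import measurable_realfun ring lra.

Set Implicit Arguments.
Unset Strict Implicit.
Unset Printing Implicit Defensive.

Import Order.TTheory GRing.Theory Num.Theory.
Import numFieldNormedType.Exports.

Local Open Scope classical_set_scope.
Local Open Scope ring_scope.

(** If [p] in the group had mismatch below [eps0], comparing [g_{n+1}] with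
    [p \o g~_n^-1], whose length is at most [T n = len p + \sum_(k <= n) len g_k],
    gives [len g_{n+1} ^ beta + eta * lambda_{n+1} <= T n ^ beta] for some
    [eta > 0] and all large [n]. Hence [T] at most doubles at each step, and
    since [lambda_n >= c 2 ^ (beta n)] the gain [eta * lambda_{n+1}] is a fixed
    fraction of [T n ^ beta]: the growth factor of [T] is bounded by some
    [q < 2], whereas [T n >= c' 2 ^ n], a contradiction.

    What makes the length subadditive with constant one (any larger constant
    would ruin the competition with [2 ^ (beta n)]) is that two controls of
    norms [a] and [b] can be concatenated at time [a / (a + b)] into a control
    of norm [a + b]. Inverses come from time reversal, together with existence
    and uniqueness for Caratheodory differential equations whose Lipschitz
    constant is square integrable in time. *)

(** * Affine changes of variables for the Lebesgue integral *)

Section affine_substitution.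
Context {R : realType}.
Notation mu := (@lebesgue_measure R).
Variables p q : R.
Hypothesis q0 : q != 0.
Let phi : measurableTypeR R -> measurableTypeR R := fun t => p + q * t.

Let mphi : measurable_fun [set: measurableTypeR R] phi.
Proof. by apply: measurable_funD => //; exact: measurable_funM. Qed.

Let nu : {measure set (measurableTypeR R) -> \bar R} :=
  mscale (NngNum (normr_ge0 q))
    (measure_function_pushforward__canonical__measure_function_Measure mu mphi).

(** Both sides are measures in [A], so it suffices to compare them on intervals []a, b]]. For
    [q < 0] the map reverses order and the preimage is closed on the left and open on the right,
    which has the same length. *)
Lemma lebesgue_measure_affine (A : set R) : measurable A ->
  mu A = (`|q|%:E * mu (phi @^-1` A))%E.
Proof.
move=> mA; apply: (@lebesgue_measure_unique R nu) => // X [[a b] _ <-].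
rewrite /nu /= /mscale /= /pushforward /=.
have mul (x y : R) : (`|q|%:E * (if (x < y)%R then (y - x)%:E else 0) =
    if (x < y)%R then (`|q| * (y - x))%:E else 0)%E.
  by case: ifP => _ //; rewrite mule0.
have /orP[qs|qs] : (0 < q) || (q < 0) by rewrite orbC -neq_lt.
- have -> : phi @^-1` `]a, b] = `](a - p) / q, (b - p) / q]%classic.
    apply/seteqP; split=> t; rewrite /phi /= !in_itv /=;
      rewrite ltr_pdivrMr// ler_pdivlMr// => /andP[] ? ?; apply/andP; lra.
  rewrite !lebesgue_measure_itv /= !lte_fin -!EFinB mul.
  rewrite ltr_pM2r ?invr_gt0// ltrD2r; case: ifP => //= _; congr (_%:E).
  by rewrite gtr0_norm//; field; rewrite gt_eqF.
- have -> : phi @^-1` `]a, b] = `[(b - p) / q, (a - p) / q[%classic.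
    apply/seteqP; split=> t; rewrite /phi /= !in_itv /=;
      rewrite ltr_ndivlMr// ler_ndivrMr// => /andP[] ? ?; apply/andP; lra.
  rewrite !lebesgue_measure_itv /= !lte_fin -!EFinB mul.
  rewrite ltr_nM2r ?invr_lt0// ltrD2r; case: ifP => //= _; congr (_%:E).
  by rewrite ltr0_norm//; field; rewrite lt_eqF.
Qed.

Lemma ge0_integral_affine (D : set R) (f : R -> \bar R) : measurable D ->
  measurable_fun D f -> (forall x, D x -> 0 <= f x)%E ->
  (\int[mu]_(x in D) f x = `|q|%:E * \int[mu]_(t in phi @^-1` D) f (phi t))%E.
Proof.
move=> mD mf f0.
have mphiD : measurable (phi @^-1` D) by rewrite -[X in measurable X]setTI; exact: mphi.
rewrite -(@ge0_integral_pushforward _ _ _ _ R phi mphi mu D f)//; last first.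
  by move=> x /set_mem; exact: f0.
rewrite -[X in (X * _)%E]/((NngNum (normr_ge0 q))%:num%:E) -ge0_integral_mscale//.
by apply: eq_measure_integral => //= A mA _; exact: lebesgue_measure_affine.
Qed.

Lemma integrable_affine (D : set R) (f : R -> \bar R) : measurable D ->
  mu.-integrable D f -> mu.-integrable (phi @^-1` D) (f \o phi).
Proof.
move=> mD /integrableP[mf iff].
have mphiD : measurable (phi @^-1` D) by rewrite -[X in measurable X]setTI; exact: mphi.
apply/integrableP; split.
  apply: measurable_comp mf _ => //; first by move=> _ [t Dt <-].
  exact: measurable_funTS.
move: iff; rewrite ge0_integral_affine//; last exact: measurableT_comp.
(* If the transported integral were infinite, multiplying it by [|q| > 0] would leave it
   infinite. *)
apply: contraTT; rewrite -!leNgt !leye_eq => /eqP /= ->.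
by rewrite mulry gtr0_sg ?mul1e// normr_gt0.
Qed.

Lemma Rintegral_affine (D : set R) (f : R -> R) : measurable D ->
  mu.-integrable D (EFin \o f) ->
  \int[mu]_(x in D) f x = `|q| * \int[mu]_(t in phi @^-1` D) f (phi t).
Proof.
move=> mD intf.
have mphiD : measurable (phi @^-1` D) by rewrite -[X in measurable X]setTI; exact: mphi.
have := integrable_affine mD intf => intfphi.
rewrite /Rintegral -[X in X * _]/(fine `|q|%:E) -fineM//; last first.
  exact: integrable_fin_num.
congr fine; rewrite integralE [in RHS]integralE muleBr//; last first.
  apply: fin_num_adde_defr; apply: integrable_pos_fin_num => //.
have [mf _] := integrableP _ _ _ intf.
congr (_ - _)%E.
- have := ge0_integral_affine mD (measurable_funepos mf).
  rewrite -/phi => ->; last by move=> x _; exact: funepos_ge0.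
  by congr (_ * _)%E; apply: eq_integral => x _; rewrite !funeposE.
- have := ge0_integral_affine mD (measurable_funeneg mf).
  rewrite -/phi => ->; last by move=> x _; exact: funeneg_ge0.
  by congr (_ * _)%E; apply: eq_integral => x _; rewrite !funenegE.
Qed.

End affine_substitution.

(** * Caratheodory differential equations *)

Section row_vectors.
Context {R : realType} {N : nat}.
Local Notation V := 'rV[R]_N.

Lemma rV_norm_le (v : V) (b : R) :
  0 <= b -> (forall i, `|v ord0 i| <= b) -> `|v| <= b.
Proof.
move=> b0 vb; rewrite /Num.norm /= mx_normrE; apply/bigmax_leP; split=> //.
by move=> [i j] _ /=; rewrite ord1; exact: vb.
Qed.

Lemma coord_norm_le (v : V) i : `|v ord0 i| <= `|v|.
Proof.
rewrite [leRHS]/Num.norm /= mx_normrE.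
exact: (@le_bigmax _ _ _ 0 (fun ij : 'I_1 * 'I_N => `|v ij.1 ij.2|) (ord0, i)).
Qed.

Lemma cvg_rV (T : Type) (F : set_system T) (FF : Filter F) (c : T -> V) (l : V) :
  (forall i, c x ord0 i @[x --> F] --> l ord0 i) -> c x @[x --> F] --> l.
Proof.
move=> cl; apply/cvgrPdist_le => e e0.
have : \forall x \near F, forall i, `|l ord0 i - c x ord0 i| <= e.
  by apply: filter_forall => i; have /cvgrPdist_le := cl i; apply.
apply: filterS => x h; apply: rV_norm_le => [|i]; first exact: ltW.
by rewrite !mxE.
Qed.

Lemma within_continuous_rV (A : set R) (c : R -> V) :
  (forall i, {within A, continuous (fun t => c t ord0 i)}) ->
  {within A, continuous c}.
Proof.
move=> cc; apply/subspace_continuousP => x Ax; apply: cvg_rV => i.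
by have /subspace_continuousP := cc i; apply.
Qed.

Lemma within_continuous_coord (A : set R) (c : R -> V) i :
  {within A, continuous c} -> {within A, continuous (fun t => c t ord0 i)}.
Proof.
move=> /subspace_continuousP cc; apply/subspace_continuousP => x Ax.
exact: (cvg_comp _ _ (cc x Ax) (@coord_continuous R 1 N ord0 i (c x))).
Qed.

End row_vectors.

(** The primitive [expR (k * s) / k] contributes a negative term at 0, which is dropped. This bounds
    the exponential weight in the contraction estimate. *)
Lemma Rintegral_expR_le (R : realType) (k t : R) : 0 < k -> 0 <= t ->
  \int[lebesgue_measure]_(s in `[0%R, t]) expR (k * s) <= expR (k * t) / k.
Proof.
move=> k0; rewrite le_eqVlt => /predU1P[<-|t0].
  by rewrite set_itv1 Rintegral_set1 divr_ge0 ?expR_ge0// ltW.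
pose F s := k^-1 * expR (k * s).
have dF (s : R) : is_derive s (1 : R) F (expR (k * s)).
  rewrite /F; apply: is_derive_eq.
  by rewrite /GRing.scale /= mulr1; field; rewrite gt_eqF.
have cF : continuous F.
  by move=> s; apply: differentiable_continuous; apply/derivable1_diffP; case: (dF s).
rewrite /Rintegral (continuous_FTC2 (F := F))//=.
- by rewrite /F mulr0 expR0 mulr1 mulrC lerBlDr lerDl invr_ge0 ltW.
- apply: continuous_subspaceT => s; apply: continuous_comp; last exact: continuous_expR.
  by apply: cvgM; [exact: cvg_cst|exact: cvg_id].
- split.
  + by move=> s _; case: (dF s).
  + by apply: cvg_at_right_filter; exact: cF.
  + by apply: cvg_at_left_filter; exact: cF.
- by move=> s _; rewrite derive1E; exact: derive_val.
Qed.

Section caratheodory.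
Context {R : realType} {N : nat}.
Local Notation V := 'rV[R]_N.
Local Notation I01 := (`[0%R, 1%R]%classic : set R).
Local Notation mu := (@lebesgue_measure R).
Variables (f : R -> V -> V) (L : R -> R).
Hypothesis L_ge0 : forall t, I01 t -> 0 <= L t.
Hypothesis mL : measurable_fun I01 L.
Hypothesis L2 : mu.-integrable I01 (fun t => (L t ^+ 2)%:E).
Hypothesis f_le : forall t x, I01 t -> `|f t x| <= L t.
Hypothesis f_lip : forall t x y, I01 t -> `|f t x - f t y| <= L t * `|x - y|.
Hypothesis mf : forall c : R -> V, {within I01, continuous c} ->
  forall i, measurable_fun I01 (fun t => f t (c t) ord0 i).

Definition caratheodory_solution (x : V) (c : R -> V) :=
  {within I01, continuous c} /\ forall t, I01 t -> forall i,
    c t ord0 i = x ord0 i + \int[mu]_(s in `[0%R, t]) f s (c s) ord0 i.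

Let mI01 : measurable (I01 : set (measurableTypeR R)). Proof. exact: measurable_itv. Qed.

Let sub01 t : I01 t -> `[0%R, t]%classic `<=` I01.
Proof.
rewrite /= in_itv/= => /andP[t0 t1] s; rewrite /= !in_itv/= => /andP[-> st].
exact: le_trans t1.
Qed.

Let integrable_sub t g : I01 t -> mu.-integrable I01 g -> mu.-integrable `[0, t] g.
Proof.
move=> It; apply: integrableS => //.
exact: sub01.
Qed.

(** [L <= 1 + L ^ 2], and the right-hand side is integrable on the bounded interval. *)
Let integrable1 : mu.-integrable I01 (EFin \o L).
Proof.
have i1 : mu.-integrable I01 (EFin \o cst 1).
  apply: continuous_compact_integrable; first exact: segment_compact.
  by apply: continuous_subspaceT => x; exact: cvg_cst.
have i2 := integrableD mI01 i1 L2.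
apply: le_integrable i2 => //; first exact/measurable_EFinP.
move=> t It; rewrite lee_fin !ger0_norm ?L_ge0//=.
  by have := sqr_ge0 (L t - 1); have := sqr_ge0 (L t); lra.
by rewrite addr_ge0// sqr_ge0.
Qed.

Lemma caratheodory_integrable c i : {within I01, continuous c} ->
  mu.-integrable I01 (EFin \o (fun t => f t (c t) ord0 i)).
Proof.
move=> cc; apply: le_integrable integrable1 => //; first by apply/measurable_EFinP; exact: mf.
move=> t It /=; rewrite lee_fin [leRHS]ger0_norm ?L_ge0//.
by apply: le_trans (f_le _ It); exact: coord_norm_le.
Qed.

Definition picard (x : V) (c : R -> V) (t : R) : V :=
  \row_i (x ord0 i + \int[mu]_(s in `[0%R, t]) f s (c s) ord0 i).

Lemma caratheodory_solutionP x c : {within I01, continuous c} ->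
  caratheodory_solution x c <-> forall t, I01 t -> c t = picard x c t.
Proof.
move=> cc; split=> [[_ h] t It|h].
  by apply/rowP => i; rewrite mxE h.
by split=> // t It i; rewrite {1}(h t It) mxE.
Qed.

Lemma picard_continuous x c : {within I01, continuous c} ->
  {within I01, continuous (picard x c)}.
Proof.
move=> cc; apply: within_continuous_rV => i.
have -> : (fun t => picard x c t ord0 i) = (fun=> x ord0 i) +
    (fun t => \int[mu]_(s in `[0, t]) f s (c s) ord0 i).
  by apply/funext => t; rewrite mxE.
apply: within_continuousD; first by apply: continuous_subspaceT => t; exact: cvg_cst.
by apply: parameterized_integral_continuous => //; exact: caratheodory_integrable.
Qed.

Let Lam : R := \int[mu]_(s in I01) L s.

Let Lam_ge0 : 0 <= Lam.
Proof. by apply: Rintegral_ge0. Qed.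

(** The bound is uniform in [c]. It starts both inductions below: the first Picard step is at most
    [Lam], and two solutions differ by at most [Lam + Lam]. *)
Lemma picard_bound x c t : {within I01, continuous c} -> I01 t ->
  `|picard x c t - x| <= Lam.
Proof.
move=> cc It; apply: rV_norm_le => // i; rewrite !mxE addrAC subrr add0r.
have intf := integrable_sub It (caratheodory_integrable i cc).
apply: (le_trans (le_normr_Rintegral _ _)) => //.
apply: (@le_trans _ _ (\int[mu]_(s in `[0%R, t]) L s)).
  apply: le_Rintegral => //.
  - exact: (integrable_norm intf).
  - exact: integrable_sub.
  - move=> s /(sub01 It) Is; apply: le_trans (f_le _ Is); exact: coord_norm_le.
rewrite /Rintegral fine_le//.
- by apply: integrable_fin_num => //; exact: integrable_sub.
- exact: integrable_fin_num.
- apply: ge0_subset_integral => //.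
  + exact/measurable_EFinP.
  + exact: sub01.
Qed.

Let M : R := \int[mu]_(s in I01) L s ^+ 2.
(** The rate of the exponential weight: it is positive even if [L] vanishes, and it gives
    [M / K <= 1]. *)
Let K : R := M + 1.
Let M_ge0 : 0 <= M.
Proof. by apply: Rintegral_ge0 => s _; exact: sqr_ge0. Qed.
Let K_gt0 : 0 < K. Proof. by rewrite /K; have := M_ge0; lra. Qed.

Let continuous_expK : continuous (fun s : R => expR (2 * K * s)).
Proof.
move=> s; apply: continuous_comp; last exact: continuous_expR.
by apply: cvgM; [exact: cvg_cst|exact: cvg_id].
Qed.

(* Square integrability of [L] gives a contraction for the norm
   [sup_t |c t| exp(- K t)], with no need for absolutely continuous weights. *)
Lemma picard_contraction x c d B : {within I01, continuous c} ->
  {within I01, continuous d} -> 0 <= B ->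
  (forall s, I01 s -> `|c s - d s| <= B * expR (K * s)) ->
  forall t, I01 t ->
    `|picard x c t - picard x d t| <= 3 / 4 * B * expR (K * t).
Proof.
move=> cc cd B0 cdB t It.
have E0 : 0 < expR (K * t) by exact: expR_gt0.
have t0 : 0 <= t by move: It; rewrite /= in_itv/= => /andP[].
apply: rV_norm_le => [|i]; first by rewrite !mulr_ge0// ltW.
have mt : measurable (`[0%R, t]%classic : set (measurableTypeR R)) by exact: measurable_itv.
have ic := integrable_sub It (caratheodory_integrable i cc).
have id := integrable_sub It (caratheodory_integrable i cd).
rewrite !mxE opprD addrACA subrr add0r -RintegralB//.
have icd : mu.-integrable `[0, t]
    (EFin \o (fun s => f s (c s) ord0 i - f s (d s) ord0 i)).
  by have := integrableB mt ic id; apply: eq_integrable.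
apply: (le_trans (le_normr_Rintegral _ _)) => //.
(* [th] is the AM-GM weight for which both resulting terms are multiples of [B * E]: the
   coefficients [M / (2 K)] and [1 / 4] add up to at most [3 / 4]. *)
pose E := expR (K * t); pose th := E / K.
have th0 : 0 < th by exact: divr_gt0.
have iL2 := integrable_sub It L2.
have ie : mu.-integrable `[0, t] (EFin \o (fun s => expR (2 * K * s))).
  apply: continuous_compact_integrable; first exact: segment_compact.
  by apply: continuous_subspaceT; exact: continuous_expK.
have iL2' : mu.-integrable `[0, t] (EFin \o (fun s => (B * th / 2) * L s ^+ 2)).
  by have := integrableZl mt (B * th / 2) iL2; apply: eq_integrable.
have ie' : mu.-integrable `[0, t]
    (EFin \o (fun s => (B / (2 * th)) * expR (2 * K * s))).
  by have := integrableZl mt (B / (2 * th)) ie; apply: eq_integrable.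
apply: (@le_trans _ _ (\int[mu]_(s in `[0%R, t])
    ((B * th / 2) * L s ^+ 2 + (B / (2 * th)) * expR (2 * K * s)))).
  apply: le_Rintegral => //.
  - exact: integrable_norm icd.
  - by have := integrableD mt iL2' ie'; apply: eq_integrable.
  - move=> s /(sub01 It) Is.
    have Ls := L_ge0 Is.
    have h : `|f s (c s) ord0 i - f s (d s) ord0 i| <= L s * (B * expR (K * s)).
      have := coord_norm_le (f s (c s) - f s (d s)) i; rewrite !mxE => h.
      apply: (le_trans h); apply: (le_trans (f_lip _ _ Is)).
      by rewrite ler_wpM2l// cdB.
    apply: (le_trans h).
    have -> : expR (2 * K * s) = expR (K * s) ^+ 2.
      by rewrite -expRM_natl; congr expR; ring.
    (* AM-GM: [2 L e <= th L^2 + e^2 / th] *)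
    rewrite -subr_ge0.
    have -> : B * th / 2 * L s ^+ 2 + B / (2 * th) * expR (K * s) ^+ 2 -
        L s * (B * expR (K * s)) = B / (2 * th) * (th * L s - expR (K * s)) ^+ 2.
      by field; rewrite gt_eqF.
    by rewrite mulr_ge0 ?sqr_ge0// divr_ge0// mulr_ge0// ltW.
rewrite RintegralD// RintegralZl// RintegralZl//.
have h1 : \int[mu]_(s in `[0%R, t]) L s ^+ 2 <= M.
  rewrite /M /Rintegral fine_le//.
  - exact: integrable_fin_num.
  - exact: integrable_fin_num.
  - apply: ge0_subset_integral => //; last exact: sub01.
    + by case/integrableP: L2.
    + by move=> s _; rewrite lee_fin sqr_ge0.
have h2 : \int[mu]_(s in `[0%R, t]) expR (2 * K * s) <= E ^+ 2 / (2 * K).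
  apply: le_trans (Rintegral_expR_le _ t0) _; first by rewrite mulr_gt0.
  rewrite (_ : E ^+ 2 = expR (2 * K * t)) ?lexx// /E -expRM_natl.
  by congr expR; ring.
apply: (@le_trans _ _ (B * th / 2 * M + B / (2 * th) * (E ^+ 2 / (2 * K)))).
  by rewrite lerD// ler_wpM2l// ?divr_ge0// mulr_ge0// ltW.
have -> : B * th / 2 * M + B / (2 * th) * (E ^+ 2 / (2 * K)) =
    B * E * (M / K / 2 + 1 / 4).
  by rewrite /th; field; rewrite !gt_eqF.
have MK : M / K <= 1 by rewrite ler_pdivrMr// mul1r /K lerDl.
rewrite -subr_ge0 -/E.
have -> : 3 / 4 * B * E - B * E * (M / K / 2 + 1 / 4) = B * E * ((1 - M / K) / 2).
  by field; rewrite gt_eqF.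
by rewrite mulr_ge0 ?divr_ge0 ?subr_ge0// mulr_ge0// ltW.
Qed.

Let expK_ge1 t : I01 t -> 1 <= expR (K * t).
Proof.
rewrite /= in_itv/= => /andP[t0 _]; rewrite -[leLHS]expR0 ler_expR.
by rewrite mulr_ge0// ltW.
Qed.

Let expK_le t : I01 t -> expR (K * t) <= expR K.
Proof.
rewrite /= in_itv/= => /andP[_ t1]; rewrite ler_expR.
by rewrite -[leRHS]mulr1 ler_pM2l.
Qed.

Let geometric_le (x A : R) : (forall n, x <= (3 / 4) ^+ n * A) -> x <= 0.
Proof.
move=> h.
have cv : A * (3 / 4) ^+ n @[n --> \oo] --> (0 : R).
  by apply: cvg_geometric; rewrite ger0_norm; lra.
rewrite -(cvg_lim _ cv)//; apply: limr_ge; first by apply/cvg_ex; exists 0.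
by apply: nearW => n; rewrite mulrC; exact: h.
Qed.

(** Both solutions are fixed points of [picard], so the crude bound [Lam + Lam] on their distance
    can be contracted indefinitely. *)
Lemma caratheodory_unique x c d :
  caratheodory_solution x c -> caratheodory_solution x d ->
  forall t, I01 t -> c t = d t.
Proof.
move=> sc sd t It.
have [cc cd] := (sc.1, sd.1).
have fc := (caratheodory_solutionP x cc).1 sc.
have fd := (caratheodory_solutionP x cd).1 sd.
pose B := Lam + Lam.
have B0 : 0 <= B by rewrite addr_ge0.
have h n : forall s, I01 s -> `|c s - d s| <= (3 / 4) ^+ n * B * expR (K * s).
  elim: n => [|n IH] s Is.
    rewrite expr0 mul1r (@le_trans _ _ B)//; last by rewrite ler_peMr// expK_ge1.
    rewrite (fc s Is) (fd s Is) (_ : _ - _ =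
      (picard x c s - x) - (picard x d s - x)); last by rewrite opprB addrA subrK.
    by apply: (le_trans (ler_normB _ _)); apply: lerD; exact: picard_bound.
  rewrite exprS (fc s Is) (fd s Is) -[3 / 4 * _ * B]mulrA.
  apply: picard_contraction => //.
  by rewrite mulr_ge0// exprn_ge0; lra.
apply/eqP; rewrite -subr_eq0 -normr_le0.
apply: (@geometric_le _ (B * expR (K * t))) => n.
by rewrite mulrA; exact: h.
Qed.

(** Picard iteration from the constant curve [x]. The iterates are uniformly Cauchy at a geometric
    rate; the limit is formed coordinate by coordinate and is a continuous fixed point. *)
Lemma caratheodory_exists x : exists c, caratheodory_solution x c.
Proof.
pose c n := iter n (picard x) (fun=> x).
have cc n : {within I01, continuous (c n)}.
  elim: n => [|n IH]; first by apply: continuous_subspaceT => t; exact: cvg_cst.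
  exact: picard_continuous.
have step n : forall t, I01 t ->
    `|c n.+1 t - c n t| <= (3 / 4) ^+ n * Lam * expR (K * t).
  elim: n => [|n IH] t It.
    rewrite expr0 mul1r; apply: (@le_trans _ _ Lam); first exact: (picard_bound _ (cc 0%N) It).
    by rewrite ler_peMr// expK_ge1.
  rewrite exprS -[3 / 4 * _ * Lam]mulrA.
  apply: (picard_contraction x (cc n.+1) (cc n) _ IH It).
  by rewrite mulr_ge0// exprn_ge0; lra.
(* The factor 4 is the sum of the geometric series of ratio [3 / 4]; [expR K] bounds the weight on
   the unit interval. *)
pose A := 4 * Lam * expR K.
have A0 : 0 <= A by rewrite !mulr_ge0// expR_ge0.
have cauchyc n k t : I01 t -> `|c (n + k)%N t - c n t| <= (3 / 4) ^+ n * A.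
  move=> It.
  (* The sharper telescoping bound is what makes the induction on [k] close. *)
  have : `|c (n + k)%N t - c n t| <= ((3 / 4) ^+ n - (3 / 4) ^+ (n + k)) * A.
    elim: k => [|k IH]; first by rewrite addn0 !subrr normr0 mul0r.
    rewrite addnS -(subrKA (c (n + k)%N t)).
    apply: (le_trans (ler_normD _ _)); apply: (le_trans (lerD (step _ _ It) IH)).
    have := expK_le It; have : 0 <= (3 / 4) ^+ (n + k) * Lam.
      by rewrite mulr_ge0// exprn_ge0; lra.
    rewrite exprS /A; set y := _ ^+ (n + k) => yL eK.
    have := ler_wpM2l yL eK; lra.
  by move/le_trans; apply; rewrite ler_wpM2r// gerBl exprn_ge0; lra.
have small (e : R) : 0 < e -> exists n, (3 / 4) ^+ n * A <= e.
  move=> e0; apply: contrapT => /forallNP h.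
  have : e <= 0 by apply: (@geometric_le _ A) => n; apply/ltW; rewrite ltNge; exact/negP.
  by rewrite leNgt e0.
have cvc t i : I01 t -> cvgn (fun n => c n t ord0 i).
  move=> It; apply: cauchy_cvg; apply: cauchy_exP => e e0.
  have [n ne] := small (e / 2) (divr_gt0 e0 (ltr0Sn _ _)).
  exists (c n t ord0 i); exists n => // m /= nm.
  rewrite /ball /= -(subnKC nm) distrC.
  have := coord_norm_le (c (n + (m - n))%N t - c n t) i; rewrite !mxE => h.
  have := cauchyc n (m - n)%N t It; lra.
pose l t : V := \row_i limn (fun n => c n t ord0 i).
have cl n t : I01 t -> `|l t - c n t| <= (3 / 4) ^+ n * A.
  move=> It; apply: rV_norm_le => [|i]; first by rewrite mulr_ge0// exprn_ge0; lra.
  rewrite !mxE.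
  have h : `|c m t ord0 i - c n t ord0 i| @[m --> \oo] -->
      `|limn (fun n => c n t ord0 i) - c n t ord0 i|.
    by apply: cvg_norm; apply: cvgB; [exact: cvc|exact: cvg_cst].
  rewrite -(cvg_lim _ h)//; apply: limr_le; first exact: cvgP h.
  exists n => // m /= nm; rewrite -(subnKC nm).
  have := coord_norm_le (c (n + (m - n))%N t - c n t) i; rewrite !mxE => h'.
  exact: le_trans h' (cauchyc _ _ _ It).
have cvl : {within I01, continuous l}.
  apply/subspace_continuousP => t It; apply/cvgrPdist_le => e e0.
  have [n ne] := small (e / 3) (divr_gt0 e0 (ltr0Sn _ _)).
  have /subspace_continuousP /(_ t It) /cvgrPdist_le /(_ (e / 3)) := cc n.
  move=> /(_ (divr_gt0 e0 (ltr0Sn _ _))).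
  rewrite !near_withinE.
  apply: filterS => s h Is; have {}h := h Is.
  rewrite (_ : l t - l s = (l t - c n t) + (c n t - c n s) - (l s - c n s)); last first.
    by rewrite subrKA opprB addrA subrK.
  have := ler_normB ((l t - c n t) + (c n t - c n s)) (l s - c n s).
  have := ler_normD (l t - c n t) (c n t - c n s).
  have := cl n t It; have := cl n s Is; lra.
exists l; apply/caratheodory_solutionP => // t It.
apply/eqP; rewrite -subr_eq0 -normr_le0.
(* [l] and [picard x l] are both compared with [c n.+1], which is [picard x (c n)]. *)
apply: (@geometric_le _ (A + A * expR (K * t))) => n.
rewrite -(subrKA (c n.+1 t)); apply: (le_trans (ler_normD _ _)).
have q0 : 0 <= (3 / 4) ^+ n :> R by rewrite exprn_ge0; lra.
have h1 := cl n.+1 t It.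
have h2 : `|c n.+1 t - picard x l t| <= 3 / 4 * ((3 / 4) ^+ n * A) * expR (K * t).
  apply: picard_contraction => //; first exact: mulr_ge0.
  move=> s Is; rewrite distrC; apply: (le_trans (cl n s Is)).
  by rewrite ler_peMr ?expK_ge1// mulr_ge0.
have qA : 0 <= (3 / 4) ^+ n * A by rewrite mulr_ge0.
have qAe : 0 <= (3 / 4) ^+ n * A * expR (K * t) by rewrite mulr_ge0// expR_ge0.
move: h1 h2; rewrite exprS mulrDr; lra.
Qed.



End caratheodory.

(** * Lipschitz estimates for admissible vector fields *)

(* Outside of [O] the function vanishes, so the mean value theorem only has to
   be applied up to the first zero. *)
Lemma mean_value_vanishing (R : realType) (q : R -> R) (O : set R) (D : R) :
  0 <= D -> continuous q -> (forall s, ~ O s -> q s = 0) ->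
  (forall s, O s -> exists2 d, is_derive s (1 : R) q d & `|d| <= D) ->
  `|q 1 - q 0| <= 2 * D.
Proof.
move=> D0 cq qO dq.
have mvt (p : R -> R) (P : set R) b : 0 <= b -> b <= 1 -> continuous p ->
    (forall s, 0 <= s < b -> P s) ->
    (forall s, P s -> exists2 d, is_derive s (1 : R) p d & `|d| <= D) ->
    `|p b - p 0| <= D.
  move=> b0 b1 cp Pb dp.
  (* The derivative is made a total function, with the arbitrary value 0 outside [P], as the mean
     value theorem requires. *)
  have /choice[d hd] : forall s, exists d, P s -> is_derive s (1 : R) p d /\ `|d| <= D.
    move=> s; have [Ps|nPs] := pselect (P s); last by exists 0.
    by have [d ? ?] := dp s Ps; exists d.
  move: b0; rewrite le_eqVlt => /predU1P[<-|b0]; first by rewrite subrr normr0.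
  have [|s|c cb ->] := @MVT R p d 0 b b0.
  - move=> s; rewrite in_itv/= => /andP[s0 sb].
    by have [|] := hd s; first by apply: Pb; rewrite ltW.
  - exact: continuous_subspaceT.
  have Pc : P c by move: cb; rewrite in_itv/= => /andP[? ?]; apply: Pb; rewrite ltW.
  have [_ dc] := hd c Pc.
  rewrite subr0 normrM (gtr0_norm b0) -[leRHS]mulr1.
  by rewrite ler_pM// ltW.
(* The zeros of [p] in the unit interval form a compact set. Before its least element [c] the
   function does not vanish, so [P] holds there and the mean value theorem applies up to [c]. *)
have first_zero (p : R -> R) (P : set R) : continuous p ->
    (forall s, ~ P s -> p s = 0) ->
    (forall s, P s -> exists2 d, is_derive s (1 : R) p d & `|d| <= D) ->
    (exists2 z, 0 <= z <= 1 & p z = 0) -> `|p 0| <= D.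
  move=> cp pP dp [z z01 pz].
  pose A := `[0, 1]%classic `&` p @^-1` [set 0].
  have cA : compact A.
    apply: compact_closedI; first exact: segment_compact.
    by apply: closed_comp => [x _|]; [exact: cp|exact: closed_eq].
  have [||c] := @compact_EVT_min R R idfun A _ cA.
  - by exists z; split=> //=; rewrite in_itv.
  - by apply: continuous_subspaceT => x; exact: cvg_id.
  rewrite inE => -[]; rewrite /= in_itv/= => /andP[c0 c1] pc minc.
  have := mvt p P c c0 c1 cp _ dp; rewrite pc sub0r normrN; apply => s /andP[s0 sc].
  apply: contrapT => /pP ps.
  have : c <= s.
    by apply: minc; rewrite inE; split=> //=; rewrite in_itv/= s0 ltW// (lt_le_trans sc).
  by rewrite leNgt sc.
(* If [q] has a zero, each of [q 0] and [q 1] is at most [D] in absolute value, the latter by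
   reflecting the interval; hence the factor 2. Otherwise [O] contains the whole segment. *)
have [[z z01 qz]|nz] := pselect (exists2 z, 0 <= z <= 1 & q z = 0).
  have q0D : `|q 0| <= D by apply: (first_zero q O) => //; exists z.
  have q1D : `|q 1| <= D.
    have e1 : q 1 = (q \o (fun s => 1 - s)) 0 by rewrite /= subr0.
    rewrite e1; apply: (first_zero _ ((fun s => 1 - s) @^-1` O)).
    - move=> s; apply: continuous_comp; last exact: cq.
      by apply: cvgB; [exact: cvg_cst|exact: cvg_id].
    - by move=> s /= ?; exact: qO.
    - move=> s /= /dq[d dqs dD]; exists (- d); last by rewrite normrN.
      have da : is_derive s (1 : R) (fun s => 1 - s) (-1).
        by apply: is_derive_eq; rewrite add0r mul1r.
      have := @is_derive1_comp R q (fun s => 1 - s) s d (-1) dqs da.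
      by rewrite mulrN1.
    - by exists (1 - z); [lra|rewrite /= opprB addrC subrK].
  by apply: (le_trans (ler_normB _ _)); lra.
apply: (@le_trans _ _ D); last lra.
apply: (mvt q O) => // s /andP[s0 s1]; apply: contrapT => /qO qs.
by apply: nz; exists s => //; rewrite s0 ltW.
Qed.

Section admissible_fields.
Context {R : realType} {N : nat}.
Local Notation V := 'rV[R]_N.

Lemma mulmx_norm_le (v : V) (J : 'M[R]_N) : `|v *m J| <= N%:R * (`|v| * `|J|).
Proof.
apply: rV_norm_le => [|i]; first by rewrite !mulr_ge0.
rewrite mxE; apply: (le_trans (ler_norm_sum _ _ _)).
apply: (@le_trans _ _ (\sum_(j < N) `|v| * `|J|)); last first.
  by rewrite sumr_const card_ord mulr_natl.
apply: ler_sum => j _; rewrite normrM ler_pM ?coord_norm_le//.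
rewrite [leRHS]/Num.norm /= mx_normrE.
exact: (@le_bigmax _ _ _ 0 (fun ij : 'I_N * 'I_N => `|J ij.1 ij.2|) (j, i)).
Qed.

(** At a boundary point continuity is the vanishing condition together with the extension by zero;
    at an exterior point the field is zero nearby. *)
Lemma C10_is_continuous (Omega : set V) (u : V -> V) :
  open Omega -> C10 Omega u -> continuous u.
Proof.
move=> oO cu x; have [Ox|nOx] := pselect (Omega x).
  exact: differentiable_continuous (C10_differentiable cu Ox).
have ux := C10_outside cu nOx.
apply/(@cvgrPdist_lt _ _ _ _ (nbhs_filter x)) => e e0; rewrite ux.
have : \forall y \near x, Omega y -> `|u y| < e.
  have [clx|nclx] := pselect (closure Omega x).
    have /cvgrPdist_lt /(_ e e0) := C10_boundary cu clx nOx.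
    by rewrite near_withinE; apply: filterS => y h Oy; have := h Oy; rewrite sub0r normrN.
  have : nbhs x (~` closure Omega).
    by apply: open_nbhs_nbhs; split=> //; rewrite openC; exact: closed_closure.
  by apply: filterS => y ny Oy; case: ny; exact: subset_closure.
apply: (@filterS _ (nbhs x) (nbhs_filter x)) => y h; rewrite sub0r normrN.
have [Oy|nOy] := pselect (Omega y); first exact: h.
by rewrite (C10_outside cu nOy) normr0.
Qed.

(** The segment from [y] to [x] may leave [Omega], which need not be convex. Each coordinate of [u]
    along the segment is handled by [mean_value_vanishing], the source of the factor 2; [N] comes
    from the sup norm of a matrix product. *)
Lemma C10_lipschitz (Omega : set V) (u : V -> V) (D : R) (x y : V) :
  open Omega -> C10 Omega u -> 0 <= D ->
  (forall z, Omega z -> `|jacobian u z| <= D) ->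
  `|u x - u y| <= 2 * N%:R * D * `|x - y|.
Proof.
move=> oO cu D0 uD.
apply: rV_norm_le => [|i]; first by rewrite !mulr_ge0.
pose a (s : R) : V := y + s *: (x - y).
pose q (s : R) : R := u (a s) ord0 i.
have da s : is_diff (s : R) a (fun h => h *: (x - y)).
  by rewrite /a; apply: is_diff_eq; apply/funext => h /=; rewrite add0r.
have -> : (u x - u y) ord0 i = q 1 - q 0.
  by rewrite /q /a scale1r scale0r addr0 subrKC !mxE.
have -> : 2 * N%:R * D * `|x - y| = 2 * (N%:R * (`|x - y| * D)) by ring.
apply: (@mean_value_vanishing _ q (a @^-1` Omega)).
- by rewrite !mulr_ge0.
- move=> s; apply: (@continuous_comp _ _ _ a (fun z : V => u z ord0 i)).
    by apply: differentiable_continuous.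
  apply: (@continuous_comp _ _ _ u (fun z : V => z ord0 i)).
    exact: C10_is_continuous cu _.
  exact: coord_continuous.
- by move=> s /= /(C10_outside cu); rewrite /q => ->; rewrite mxE.
- move=> s Os.
  have du := C10_differentiable cu Os.
  have dc : differentiable (fun z : V => z ord0 i) (u (a s)) by exact: differentiable_coord.
  have dua : differentiable (u \o a) s by exact: differentiable_comp.
  have dq : differentiable q s.
    exact: (@differentiable_comp _ _ _ _ (u \o a) (fun z : V => z ord0 i)).
  exists ('D_1 q s); first by apply: DeriveDef => //; exact: diff_derivable.
  rewrite deriveE//.
  (* Chain rule along the segment; vectors are rows, so the Jacobian acts on the right. *)
  have -> : 'd q s 1 = ((x - y) *m jacobian u (a s)) ord0 i.
    have -> : q = (fun z : V => z ord0 i) \o (u \o a) by [].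
    rewrite diff_comp// diff_comp//= diff_val scale1r.
    rewrite -deriveEjacobian// deriveE//.
    have lin : linear (fun z : V => z ord0 i) by move=> k z w; rewrite !mxE.
    pose co : {linear V -> R} := HB.pack (fun z : V => z ord0 i)
      (GRing.isLinear.Build R V R _ _ lin).
    by rewrite (@diff_lin _ _ _ co)//; exact: coord_continuous.
  apply: (le_trans (coord_norm_le _ _)); apply: (le_trans (mulmx_norm_le _ _)).
  by rewrite ler_wpM2l// ler_wpM2l// uD.
Qed.

End admissible_fields.

(** * Controls and their flows *)

Section strong_measurability.
Context {R : realType} {H : completeNormedModType R}.
Local Notation I01 := (`[0%R, 1%R]%classic : set R).
Local Notation mu := (@lebesgue_measure R).
Implicit Types (u s : R -> H).

(** Continuity in the second variable makes the function a pointwise limit of [F t (s n t)]. Since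
    [s n] has finitely many values, each of these is measurable, piece by piece. *)
Lemma strongly_measurable_comp u (F : R -> H -> R) :
  strongly_measurable u -> (forall h, measurable_fun I01 (F ^~ h)) ->
  (forall t, I01 t -> continuous (F t)) ->
  measurable_fun I01 (fun t => F t (u t)).
Proof.
move=> [s [ss su]] mF cF.
apply: (@measurable_fun_cvg _ _ R _ (fun n t => F t (s n t))); last first.
  by move=> t It; exact: (cvg_comp _ _ (su t It) (cF t It (u t))).
move=> n mI Y mY; have [fs ms] := ss n.
rewrite (_ : _ `&` _ = \bigcup_(h in range (s n))
    (s n @^-1` [set h] `&` (I01 `&` F ^~ h @^-1` Y))).
  by apply: fin_bigcup_measurable => // h _; apply: measurableI => //; exact: mF.
apply/seteqP; split=> [t [It /= Yt]|t [h _ [/= sh [It /= Yt]]]].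
  by exists (s n t) => //; exists t.
by split=> //=; rewrite sh.
Qed.

Lemma simple_fun_affine s (p q k : R) : q != 0 ->
  simple_fun s -> simple_fun (fun t => k *: s (p + q * t)).
Proof.
move=> q0 [fs ms]; split.
  apply: sub_finite_set (finite_image ( *:%R k) fs).
  by move=> _ [t _ <-]; exists (s (p + q * t)) => //; exists (p + q * t).
(* The union runs over all values sent to [h] by the scaling, which also covers [k = 0]. *)
move=> h; rewrite (_ : _ @^-1` _ =
  \bigcup_(h' in range s `&` [set h' | k *: h' = h])
    ((fun t => p + q * t) @^-1` (s @^-1` [set h']))).
  apply: fin_bigcup_measurable; first exact: finite_setIl.
  move=> h' _; rewrite -[X in measurable X]setTI.
  have mphi : measurable_fun [set: R] (fun t : R => p + q * t).
    by apply: measurable_funD => //; exact: measurable_funM.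
  exact: mphi.
apply/seteqP; split=> [t /= kt|t [h' [_ /= kh] /= sh]]; last by rewrite sh.
by exists (s (p + q * t)) => //=; split=> //; exists (p + q * t).
Qed.

Lemma simple_fun_if s1 s2 (th : R) : simple_fun s1 -> simple_fun s2 ->
  simple_fun (fun t => if t <= th then s1 t else s2 t).
Proof.
move=> [f1 m1] [f2 m2]; split.
  have fU : finite_set (range s1 `|` range s2) by rewrite finite_setU.
  apply: sub_finite_set fU => _ [t _ <-].
  by case: ifP => _; [left|right]; exists t.
move=> h; rewrite (_ : _ @^-1` _ =
  (`]-oo, th]%classic `&` s1 @^-1` [set h]) `|`
  (`]th, +oo[%classic `&` s2 @^-1` [set h])).
  by apply: measurableU; apply: measurableI => //; exact: measurable_itv.
apply/seteqP; split=> t /=; rewrite !in_itv/= andbT.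
  by case: ifPn => [tth ->|]; [left|rewrite -ltNge => ? ->; right].
by move=> [[-> ->]//|[]]; rewrite ltNge => /negbTE -> ->.
Qed.

Lemma strongly_measurable_affine u (p q k : R) : q != 0 ->
  (forall t, I01 t -> I01 (p + q * t)) ->
  strongly_measurable u -> strongly_measurable (fun t => k *: u (p + q * t)).
Proof.
move=> q0 I01pq [s [ss su]].
exists (fun n t => k *: s n (p + q * t)); split.
  by move=> n; exact: simple_fun_affine.
by move=> t It; apply: cvgZr; apply: su; exact: I01pq.
Qed.

Lemma strongly_measurable_if u1 u2 (th p1 q1 k1 p2 q2 k2 : R) :
  q1 != 0 -> q2 != 0 ->
  (forall t, I01 t -> t <= th -> I01 (p1 + q1 * t)) ->
  (forall t, I01 t -> th < t -> I01 (p2 + q2 * t)) ->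
  strongly_measurable u1 -> strongly_measurable u2 ->
  strongly_measurable (fun t => if t <= th then k1 *: u1 (p1 + q1 * t)
                                else k2 *: u2 (p2 + q2 * t)).
Proof.
move=> q10 q20 I1 I2 [s1 [ss1 su1]] [s2 [ss2 su2]].
exists (fun n t => if t <= th then k1 *: s1 n (p1 + q1 * t)
                   else k2 *: s2 n (p2 + q2 * t)); split.
  by move=> n; apply: simple_fun_if; exact: simple_fun_affine.
move=> t It; case: ifPn => tth; apply: cvgZr.
  by apply: su1; exact: I1.
by apply: su2; apply: I2 => //; rewrite ltNge.
Qed.

Lemma measurable_norm_strongly u : strongly_measurable u ->
  measurable_fun I01 (fun t => `|u t|).
Proof.
move=> mu_; apply: (strongly_measurable_comp (F := fun _ h => `|h|)) => //.
  by move=> t _ h; exact: norm_continuous.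
Qed.

Lemma L2H_norm_ge0 u : 0 <= L2H_norm u.
Proof. exact: sqrtr_ge0. Qed.

Lemma L2H_integrable u : L2H u ->
  mu.-integrable I01 (fun t => (`|u t| ^+ 2)%:E).
Proof.
move=> [mu_ lu]; apply/integrableP; split.
  apply/measurable_EFinP; apply: measurable_funX; exact: measurable_norm_strongly.
under eq_integral do rewrite gee0_abs ?lee_fin ?sqr_ge0//.
exact: lu.
Qed.

Lemma L2H_energy u : L2H u ->
  (\int[mu]_(t in I01) (`|u t| ^+ 2)%:E = (L2H_norm u ^+ 2)%:E)%E.
Proof.
move=> Hu; rewrite sqr_sqrtr; last by apply: Rintegral_ge0 => t _; exact: sqr_ge0.
rewrite /Rintegral fineK//; apply: integrable_fin_num => //; exact: L2H_integrable.
Qed.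

(** One estimate of the extended-valued energy yields both membership in the space and the norm
    bound. *)
Lemma L2H_norm_le u (r : R) : strongly_measurable u -> 0 <= r ->
  (\int[mu]_(t in I01) (`|u t| ^+ 2)%:E <= (r ^+ 2)%:E)%E ->
  L2H u /\ L2H_norm u <= r.
Proof.
move=> mu_ r0 ur.
have Hu : L2H u by split=> //; exact: le_lt_trans ur (ltry _).
split=> //; move: ur; rewrite L2H_energy// lee_fin => ur.
by rewrite -(@ler_pXn2r _ 2) ?nnegrE ?L2H_norm_ge0.
Qed.

End strong_measurability.

(** * Existence, uniqueness and time reversal of flows *)

Section flow_theory.
Context {R : realType} {N : nat} {H : completeNormedModType R}.
Local Notation V := 'rV[R]_N.
Local Notation I01 := (`[0%R, 1%R]%classic : set R).
Local Notation mu := (@lebesgue_measure R).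
Variables (ev : {linear H -> (V -> V)}) (K : R).
Hypothesis K_ge0 : 0 <= K.
Hypothesis ev_le : forall h x, `|ev h x| <= K * `|h|.
Hypothesis ev_lip : forall h x y, `|ev h x - ev h y| <= K * `|h| * `|x - y|.

Let evZ k h x i : ev (k *: h) x ord0 i = k * ev h x ord0 i.
Proof. by rewrite linearZ/= mxE. Qed.

Let evB h k x i : ev h x ord0 i - ev k x ord0 i = ev (h - k) x ord0 i.
Proof. by rewrite linearB/= !mxE. Qed.

Let lipschitz_continuous (U W : normedModType R) (f : U -> W) (k : R) :
  (forall x y, `|f x - f y| <= k * `|x - y|) -> continuous f.
Proof.
move=> fk x; apply/(@cvgrPdist_le _ _ _ _ (nbhs_filter x)) => e e0.
have k0 : 0 < `|k| + 1 by rewrite ltr_pwDr.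
apply: (@filterS _ (nbhs x) (nbhs_filter x) (ball x (e / (`|k| + 1)))); last first.
  by apply: nbhsx_ballx; exact: divr_gt0.
move=> y; rewrite -ball_normE /= ltr_pdivlMr// => xy.
apply: (le_trans (fk x y)); apply: le_trans (ltW xy).
by rewrite mulrC ler_wpM2l// ler_wpDr// ler_norm.
Qed.

Let ev_continuous h : continuous (ev h).
Proof. exact: lipschitz_continuous (ev_lip h). Qed.

Let ev_coord_continuous x i : continuous (fun h => ev h x ord0 i).
Proof.
apply: (@lipschitz_continuous _ _ _ K) => h k; rewrite evB.
by apply: (le_trans (coord_norm_le _ _)); exact: ev_le.
Qed.

(** [ev h (c t)] is continuous in [t] for fixed [h] and Lipschitz in [h] for fixed [t], so
    [strongly_measurable_comp] applies. *)
Let measurable_field u c i : strongly_measurable u -> {within I01, continuous c} ->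
  measurable_fun I01 (fun t => ev (u t) (c t) ord0 i).
Proof.
move=> su cc.
apply: (strongly_measurable_comp (F := fun t h => ev h (c t) ord0 i)) => // h.
apply: subspace_continuous_measurable_fun => //.
apply: (@within_continuous_coord _ _ _ (fun t => ev h (c t))).
move/subspace_continuousP : cc => cc; apply/subspace_continuousP => t It.
exact: cvg_comp (cc t It) (@ev_continuous h (c t)).
Qed.

(** This single function bounds the field at time [t] and is also a Lipschitz constant for it, as
    the theory above requires. *)
Let L (u : R -> H) t := K * `|u t|.

Let L_ge0 u t : I01 t -> 0 <= L u t. Proof. by move=> _; exact: mulr_ge0. Qed.

Let mL u : L2H u -> measurable_fun I01 (L u).
Proof.
by move=> [su _]; apply: measurable_funM => //; exact: measurable_norm_strongly.
Qed.

Let L2 u : L2H u -> mu.-integrable I01 (fun t => (L u t ^+ 2)%:E).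
Proof.
move=> Hu.
have mI : measurable (I01 : set (measurableTypeR R)) by exact: measurable_itv.
have := integrableZl mI (K ^+ 2) (L2H_integrable Hu).
by apply: eq_integrable => // t _; rewrite /L exprMn EFinM.
Qed.

Let field (u : R -> H) (t : R) (x : V) : V := ev (u t) x.

Let field_le u t x : I01 t -> `|field u t x| <= L u t.
Proof. by move=> _; exact: ev_le. Qed.

Let field_lip u t x y : I01 t -> `|field u t x - field u t y| <= L u t * `|x - y|.
Proof. by move=> _; exact: ev_lip. Qed.

Let mfield u : L2H u -> forall c, {within I01, continuous c} ->
  forall i, measurable_fun I01 (fun t => field u t (c t) ord0 i).
Proof. by move=> [su _] c cc i; exact: measurable_field. Qed.

Lemma integrable_field u c i : L2H u -> {within I01, continuous c} ->
  mu.-integrable I01 (EFin \o (fun t => ev (u t) (c t) ord0 i)).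
Proof.
move=> Hu cc.
exact: (caratheodory_integrable (@L_ge0 u) (mL Hu) (L2 Hu) (@field_le u) (mfield Hu)).
Qed.

Lemma flow_exists u : L2H u -> exists phi, is_flow ev u phi.
Proof.
move=> Hu.
have /choice[c hc] := caratheodory_exists (@L_ge0 u) (mL Hu) (L2 Hu)
  (@field_le u) (@field_lip u) (mfield Hu).
by exists (fun t x => c x t).
Qed.

Lemma flow_unique u phi x c : L2H u -> is_flow ev u phi ->
  caratheodory_solution (fun t => ev (u t)) x c ->
  forall t, I01 t -> c t = phi t x.
Proof.
move=> Hu fphi sc t It.
exact: (caratheodory_unique (@L_ge0 u) (mL Hu) (L2 Hu)
  (@field_le u) (@field_lip u) (mfield Hu) sc (fphi x) It).
Qed.

Lemma flow0 u phi : is_flow ev u phi -> phi 0 = id.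
Proof.
move=> fphi; apply/funext => x; apply/rowP => i.
have I0 : I01 0 by rewrite /= in_itv/= lexx ler01.
by rewrite (fphi x).2// set_itv1 Rintegral_set1 addr0.
Qed.

Lemma within_continuous_affine (c : R -> V) (p q : R) (A : set R) :
  (forall t, A t -> I01 (p + q * t)) -> {within I01, continuous c} ->
  {within A, continuous (fun t => c (p + q * t))}.
Proof.
move=> AI /subspace_continuousP cc; apply/subspace_continuousP => t At.
apply: cvg_comp (cc _ (AI t At)).
have h : continuous (fun s : R => p + q * s).
  move=> s; apply: cvgD; first exact: cvg_cst.
  by apply: mulrl_continuous.
move=> P nP.
have nP' : nbhs (p + q * t) (fun y => I01 y -> P y) by exact: nP.
have : nbhs t (fun s => A s -> P (p + q * s)).
  apply: (@filterS _ (nbhs t) _ (fun s => I01 (p + q * s) -> P (p + q * s))).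
    by move=> s hs /AI.
  exact: (h t _ nP').
by [].
Qed.

(** The control [- u (1 - t)], written with [p + q * t] for [p = 1] and [q = -1] to match the affine
    substitution lemmas. *)
Definition reverse_control (u : R -> H) (t : R) : H := - 1 *: u (1 + -1 * t).

Let I01_reverse t : I01 t -> I01 (1 + -1 * t).
Proof. by rewrite /= !in_itv/= => /andP[? ?]; apply/andP; lra. Qed.

Let I01_reverseE : (fun t : R => 1 + -1 * t) @^-1` I01 = I01.
Proof.
apply/seteqP; split=> t; last exact: I01_reverse.
by rewrite /= !in_itv/= => /andP[? ?]; apply/andP; lra.
Qed.

Let itv_reverse (t : R) :
  (fun s => 1 + -1 * s) @^-1` `]1 - t, 1] = `[0, t[%classic.
Proof.
by apply/seteqP; split=> s; rewrite /= !in_itv/= => /andP[? ?]; apply/andP; lra.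
Qed.

Lemma reverse_control_L2H u : L2H u ->
  L2H (reverse_control u) /\ L2H_norm (reverse_control u) <= L2H_norm u.
Proof.
move=> Hu; apply: L2H_norm_le; last 1 first.
- rewrite -(L2H_energy Hu) [leRHS](@ge0_integral_affine _ 1 (-1))//.
  + rewrite normrN1 mul1e I01_reverseE.
    rewrite le_eqVlt; apply/orP; left; apply/eqP; apply: eq_integral => t _.
    by rewrite /reverse_control scaleN1r normrN.
  + by case/integrableP: (L2H_integrable Hu).
- by apply: strongly_measurable_affine => //; case: Hu.
- exact: L2H_norm_ge0.
Qed.

(** Substitution turns the integral of the reversed field over [[0, t]] into minus the integral of
    the original one over []1 - t, 1]]; subtracting the latter from the integral over [[0, 1]]
    leaves the equation of [phi] at time [1 - t]. *)
Lemma reverse_flow u phi x : L2H u -> is_flow ev u phi ->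
  caratheodory_solution (fun t => ev (reverse_control u t)) (phi 1 x)
    (fun t => phi (1 + -1 * t) x).
Proof.
move=> Hu fphi.
have [cc hc] := fphi x.
split=> [|t It i].
  by apply: (within_continuous_affine (c := phi ^~ x)).
have I1 : I01 1 by rewrite /= in_itv/= lexx ler01.
have n1 : (-1 : R) != 0 by rewrite oppr_eq0 oner_eq0.
pose G s := ev (u s) (phi s x) ord0 i.
have intG : mu.-integrable I01 (EFin \o G) := integrable_field i Hu cc.
have intGt : mu.-integrable `]1 - t, 1] (EFin \o G).
  apply: integrableS intG => //.
  by move=> s; move: It; rewrite /= !in_itv/= => /andP[? ?] /andP[? ?]; apply/andP; lra.
have mD : measurable (`]1 - t, 1]%classic : set (measurableTypeR R)) by exact: measurable_itv.
rewrite [LHS]hc ?[phi 1 x ord0 i]hc//; last exact: I01_reverse.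
have e1 : \int[mu]_(s in `[0, t]) ev (reverse_control u s) (phi (1 + -1 * s) x) ord0 i
    = - \int[mu]_(s in `]1 - t, 1]) G s.
  have intGr : mu.-integrable `[0, t] (EFin \o (fun s => G (1 + -1 * s))).
    have mI : measurable (I01 : set (measurableTypeR R)) by exact: measurable_itv.
    have := @integrable_affine R 1 (-1) n1 _ _ mI intG; rewrite I01_reverseE.
    apply: integrableS => //.
    by move=> s; move: It; rewrite /= !in_itv/= => /andP[? ?] /andP[? ?]; apply/andP; lra.
  rewrite [X in _ = - X](@Rintegral_affine _ 1 (-1))// itv_reverse normrN1 mul1r.
  rewrite (_ : (fun s => _) = (fun s => -1 * G (1 + -1 * s))); last first.
    by apply/funext => s; rewrite evZ.
  rewrite RintegralZl// mulN1r Rintegral_itv_bndo_bndc//.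
  by apply: integrableS intGr => //; apply: subset_itvl; rewrite bnd_simp.
rewrite e1 -(@Rintegral_itvB R G (BLeft 0) (BRight 1) (1 - t))//.
- by rewrite mulN1r; ring.
- by move: It; rewrite /= in_itv/= => /andP[? ?]; rewrite bnd_simp; lra.
- by move: It; rewrite /= in_itv/= => /andP[? ?]; rewrite bnd_simp; lra.
Qed.

(** By uniqueness [psi] follows the reversed trajectory from [phi 1 x], which is back at [x] at time
    1. *)
Lemma reverse_flow_cancel u phi psi : L2H u -> is_flow ev u phi ->
  is_flow ev (reverse_control u) psi -> cancel (phi 1) (psi 1).
Proof.
move=> Hu fphi fpsi x.
have [Hr _] := reverse_control_L2H Hu.
have I1 : I01 1 by rewrite /= in_itv/= lexx ler01.
rewrite -(flow_unique Hr fpsi (reverse_flow x Hu fphi) I1).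
by rewrite mulr1 subrr (flow0 fphi).
Qed.

(** Exchanges the roles of the two flows, so that the cancellation above also gives the inverse on
    the other side. *)
Lemma reverse_controlK : involutive reverse_control.
Proof.
move=> u; apply/funext => t; rewrite /reverse_control !scaleN1r opprK.
by congr u; ring.
Qed.

End flow_theory.

(** * Concatenation of two controls *)

Section concatenation.
Context {R : realType} {N : nat} {H : completeNormedModType R}.
Local Notation V := 'rV[R]_N.
Local Notation I01 := (`[0%R, 1%R]%classic : set R).
Local Notation mu := (@lebesgue_measure R).
Variables (ev : {linear H -> (V -> V)}) (K : R).
Hypothesis K_ge0 : 0 <= K.
Hypothesis ev_le : forall h x, `|ev h x| <= K * `|h|.
Hypothesis ev_lip : forall h x y, `|ev h x - ev h y| <= K * `|h| * `|x - y|.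
Variable th : R.
Hypotheses (th_gt0 : 0 < th) (th_lt1 : th < 1).

(** [q1 * t] maps [[0, th]] onto [[0, 1]], and [p2 + q2 * t] maps [[th, 1]] onto [[0, 1]]. *)
Let q1 := th^-1.
Let q2 := (1 - th)^-1.
Let p2 := - (th * q2).
Let om_gt0 : 0 < 1 - th. Proof. by rewrite subr_gt0. Qed.
Let q1_gt0 : 0 < q1. Proof. by rewrite invr_gt0. Qed.
Let q2_gt0 : 0 < q2. Proof. by rewrite invr_gt0. Qed.
Let q1_neq0 : q1 != 0. Proof. by rewrite gt_eqF. Qed.
Let q2_neq0 : q2 != 0. Proof. by rewrite gt_eqF. Qed.

(** The factors [q1] and [q2] compensate for the change of speed; the summand 0 keeps the affine
    form [p + q * t]. *)
Definition concat_control (u v : R -> H) (t : R) : H :=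
  if t <= th then q1 *: u (0 + q1 * t) else q2 *: v (p2 + q2 * t).

Definition concat_curve (c d : R -> V) (t : R) : V :=
  if t <= th then c (0 + q1 * t) else d (p2 + q2 * t).

Let itv_left t : (fun s => 0 + q1 * s) @^-1` `[0, q1 * t] = `[0, t]%classic.
Proof.
apply/seteqP; split=> s; rewrite /= !in_itv/= add0r.
  by rewrite pmulr_rge0// ler_pM2l.
by rewrite pmulr_rge0// ler_pM2l.
Qed.

Let p2q2 s : p2 + q2 * s = q2 * (s - th).
Proof. by rewrite /p2; ring. Qed.

Let itv_right t : (fun s => p2 + q2 * s) @^-1` `]0, p2 + q2 * t] = `]th, t]%classic.
Proof.
apply/seteqP; split=> s; rewrite /= !in_itv/= !p2q2.
  by rewrite pmulr_rgt0// ler_pM2l// subr_gt0 lerD2r.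
by rewrite pmulr_rgt0// ler_pM2l// subr_gt0 lerD2r.
Qed.

Let q1th : q1 * th = 1. Proof. by rewrite mulVf// gt_eqF. Qed.
Let p2q2th : p2 + q2 * th = 0. Proof. by rewrite p2q2 subrr mulr0. Qed.
Let p2q21 : p2 + q2 * 1 = 1. Proof. by rewrite p2q2 mulVf// gt_eqF. Qed.

Let I01_left t : I01 t -> t <= th -> I01 (0 + q1 * t).
Proof.
rewrite /= !in_itv/= add0r => /andP[t0 _] tth.
by rewrite mulr_ge0 ?(ltW q1_gt0)//= -q1th ler_wpM2l// ltW.
Qed.

Let I01_right t : I01 t -> th <= t -> I01 (p2 + q2 * t).
Proof.
rewrite /= !in_itv/= => /andP[_ t1] tht.
by rewrite {1}p2q2 mulr_ge0 ?subr_ge0 ?(ltW q2_gt0)//= -p2q21 lerD2l ler_wpM2l// ltW.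
Qed.

Let setU_itv t : th <= t -> `[0, t]%classic = `[0, th] `|` `]th, t]%classic.
Proof.
by move=> tht; rewrite -itv_bndbnd_setU// bnd_simp// ltW.
Qed.

(** Scaling the velocity by [q] multiplies the energy density by [q ^ 2], and shrinking time divides
    the integral by [q]. *)
Let energy_affine (u : R -> H) (p q : R) (D : set R) : L2H u -> 0 < q ->
  measurable (D : set (measurableTypeR R)) -> D `<=` I01 ->
  (\int[mu]_(t in (fun s => (p + q * s)%R) @^-1` D) (`|q *: u (p + q * t)| ^+ 2)%:E =
    q%:E * \int[mu]_(t in D) (`|u t| ^+ 2)%:E)%E.
Proof.
move=> Hu q0 mD DI.
have qn0 : q != 0 by rewrite gt_eqF.
have mI : measurable (I01 : set (measurableTypeR R)) by exact: measurable_itv.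
have iD := integrableS mI mD DI (L2H_integrable Hu).
have [mf _] := integrableP _ _ _ iD.
have /integrableP[mfq _] := integrable_affine p qn0 mD iD.
rewrite [X in _ = (_ * X)%E](@ge0_integral_affine _ p q qn0)//.
rewrite gtr0_norm// muleA -EFinM -ge0_integralZl_EFin//.
- by apply: eq_integral => t _; rewrite normrZ exprMn gtr0_norm// expr2 EFinM.
- have mphi : measurable_fun [set: measurableTypeR R] (fun t : R => p + q * t : measurableTypeR R).
    by apply: measurable_funD => //; exact: measurable_funM.
  by rewrite -[X in measurable X]setTI; exact: mphi.
- by rewrite mulr_ge0// ltW.
Qed.

(* The squared norm is [|u|^2 / th + |v|^2 / (1 - th)], which this choice of
   [th] makes equal to [(a + b)^2] when [|u| = a] and [|v| = b]. *)
Lemma concat_control_L2H u v (a b : R) : L2H u -> L2H v ->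
  L2H_norm u <= a -> L2H_norm v <= b -> 0 < a -> 0 < b -> th = a / (a + b) ->
  L2H (concat_control u v) /\ L2H_norm (concat_control u v) <= a + b.
Proof.
move=> Hu Hv ua vb a0 b0 thE.
have swf : strongly_measurable (concat_control u v).
  apply: strongly_measurable_if => //.
  - by move=> t It tht; apply: I01_right => //; exact: ltW.
  - by case: Hu.
  - by case: Hv.
apply: L2H_norm_le => //; first by rewrite addr_ge0// ltW.
have mE : measurable_fun I01 (fun t => (`|concat_control u v t| ^+ 2)%:E).
  by apply/measurable_EFinP; apply: measurable_funX; exact: measurable_norm_strongly.
rewrite (setU_itv (ltW th_lt1)) ge0_integral_setU//=; last 2 first.
- by rewrite -setU_itv// ltW.
- apply/disj_setPS => s [] /=; rewrite !in_itv/= => /andP[_ h1] /andP[h2 _].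
  by move: h1; rewrite leNgt h2.
have e1 : (\int[mu]_(t in `[0%R, th]) (`|concat_control u v t| ^+ 2)%:E =
    q1%:E * (L2H_norm u ^+ 2)%:E)%E.
  rewrite -(L2H_energy Hu) -(@energy_affine u 0 q1)//.
  have -> : (fun s => 0 + q1 * s) @^-1` I01 = `[0, th]%classic by rewrite -(itv_left th) q1th.
  apply: eq_integral => t; rewrite inE/= in_itv/= => /andP[_ tth].
  by rewrite /concat_control tth.
have e2 : (\int[mu]_(t in `]th, 1%R]) (`|concat_control u v t| ^+ 2)%:E <=
    q2%:E * (L2H_norm v ^+ 2)%:E)%E.
  have sub : `]0%R, 1%R]%classic `<=` I01 by exact: subset_itv_oc_cc.
  rewrite -(L2H_energy Hv).
  apply: (@le_trans _ _ (q2%:E * \int[mu]_(t in `]0%R, 1%R]) (`|v t| ^+ 2)%:E)%E).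
    rewrite -(@energy_affine v p2 q2)//.
    have -> : (fun s => p2 + q2 * s) @^-1` `]0, 1] = `]th, 1]%classic.
      by rewrite -(itv_right 1) p2q21.
    rewrite le_eqVlt; apply/orP; left; apply/eqP.
    apply: eq_integral => t; rewrite inE/= in_itv/= => /andP[tht _].
    by rewrite /concat_control leNgt tht.
  rewrite lee_pmul2l//; apply: ge0_subset_integral => //.
  by case/integrableP: (L2H_integrable Hv).
rewrite e1; apply: (le_trans (leeD2l _ e2)).
rewrite -!EFinM -EFinD lee_fin.
have ab0 : 0 < a + b by exact: addr_gt0.
(* With [th = a / (a + b)] the two terms are [a * (a + b)] and [b * (a + b)]. *)
have -> : (a + b) ^+ 2 = q1 * a ^+ 2 + q2 * b ^+ 2.
  rewrite /q1 /q2 thE.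
  have -> : 1 - a / (a + b) = b / (a + b) by field; rewrite gt_eqF.
  by field; rewrite !gt_eqF.
have sq (r r' : R) : 0 <= r -> r <= r' -> r ^+ 2 <= r' ^+ 2.
  by move=> r0 rr'; rewrite ler_pXn2r ?nnegrE// (le_trans r0).
by apply: lerD; (rewrite ler_pM2l//; apply: sq => //; exact: L2H_norm_ge0).
Qed.

(** Up to time [th] the substitution reproduces the equation of [c]. After it, the integral over
    [[0, th]] accounts for the passage from [x] to [c 1], and the rest is the equation of [d]. *)
Lemma concat_solution u v x c d : L2H u -> L2H v -> L2H (concat_control u v) ->
  caratheodory_solution (fun t => ev (u t)) x c ->
  caratheodory_solution (fun t => ev (v t)) (c 1) d ->
  caratheodory_solution (fun t => ev (concat_control u v t)) x (concat_curve c d).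
Proof.
move=> Hu Hv Hw [cc hc] [cd hd].
have I1 : I01 1 by rewrite /= in_itv/= lexx ler01.
have I0 : I01 0 by rewrite /= in_itv/= lexx ler01.
have d0 : d 0 = c 1.
  by apply/rowP => i; rewrite hd// set_itv1 Rintegral_set1 addr0.
have ccd : {within I01, continuous (concat_curve c d)}.
  (* Continuity is glued along two closed intervals sharing [th], where both formulas agree because
     [d 0 = c 1]. *)
  have -> : I01 = `[0, th] `|` `[th, 1]%classic.
    rewrite (setU_itv (ltW th_lt1)); apply/seteqP; split=> s [|]; [by left| | by left|].
      by move=> h; right; exact: subset_itv_oc_cc h.
    rewrite /= !in_itv/= => /andP[ths s1]; move: ths; rewrite le_eqVlt.
    by move=> /predU1P[<-|ths]; [left|right]; rewrite ?ths ?s1// lexx ltW.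
  apply: withinU_continuous.
  - exact: itv_closed.
  - exact: itv_closed.
  - apply: (@subspace_eq_continuous _ _ _ (fun t => c (0 + q1 * t))).
      by move=> t; rewrite inE/= in_itv/= /from_subspace/concat_curve => /andP[_ ->].
    apply: within_continuous_affine cc => t /= ht; apply: I01_left.
      by move: ht; rewrite /= !in_itv/= => /andP[-> tth]; rewrite (le_trans tth)// ltW.
    by move: ht; rewrite in_itv/= => /andP[].
  - apply: (@subspace_eq_continuous _ _ _ (fun t => d (p2 + q2 * t))).
      move=> t; rewrite inE/= in_itv/= => /andP[]; rewrite le_eqVlt /from_subspace/concat_curve.
      move=> /predU1P[<- _|tht _]; last by rewrite leNgt tht.
      by rewrite lexx p2q2th add0r q1th d0.
    apply: within_continuous_affine cd => t /= ht; apply: I01_right.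
      move: ht; rewrite /= !in_itv/= => /andP[tht ->]; rewrite andbT.
      by apply: le_trans tht; exact: ltW.
    by move: ht; rewrite in_itv/= => /andP[].
split=> // t It i.
have intW := integrable_field K_ge0 ev_le ev_lip i Hw ccd.
have intc := integrable_field K_ge0 ev_le ev_lip i Hu cc.
have intd := integrable_field K_ge0 ev_le ev_lip i Hv cd.
pose W s := ev (concat_control u v s) (concat_curve c d s) ord0 i.
pose Gc s := ev (u s) (c s) ord0 i.
pose Gd s := ev (v s) (d s) ord0 i.
have evZ k h y : ev (k *: h) y ord0 i = k * ev h y ord0 i by rewrite linearZ/= mxE.
have left_int r : I01 r -> r <= th ->
    \int[mu]_(s in `[0, r]) W s = \int[mu]_(s in `[0, q1 * r]) Gc s.
  move=> Ir rth.
  have sub : `[0, q1 * r]%classic `<=` I01.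
    move=> s; have := I01_left Ir rth.
    rewrite /= !in_itv/= add0r => /andP[_ r1] /andP[-> sr].
    exact: le_trans r1.
  rewrite [RHS](@Rintegral_affine _ 0 q1)//; last first.
    by apply: integrableS intc => //; exact: sub.
  rewrite itv_left gtr0_norm// -RintegralZl//; last first.
    have mr : measurable (`[0, q1 * r]%classic : set (measurableTypeR R)) by exact: measurable_itv.
    have := integrable_affine 0 q1_neq0 mr (integrableS _ mr sub intc).
    by rewrite itv_left; apply; exact: measurable_itv.
  apply: eq_Rintegral => s; rewrite inE/= in_itv/= => /andP[_ sr].
  by rewrite /W /Gc /concat_control /concat_curve (le_trans sr rth) evZ.
have right_int r : I01 r -> th < r ->
    \int[mu]_(s in `]th, r]) W s = \int[mu]_(s in `[0, p2 + q2 * r]) Gd s.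
  move=> Ir thr.
  have sub : `]0, p2 + q2 * r]%classic `<=` I01.
    move=> s; have := I01_right Ir (ltW thr).
    rewrite /= !in_itv/= => /andP[_ r1] /andP[/ltW -> sr].
    exact: le_trans r1.
  have mr : measurable (`]0, p2 + q2 * r]%classic : set (measurableTypeR R)).
    exact: measurable_itv.
  have intdr : mu.-integrable `]0, p2 + q2 * r] (EFin \o Gd).
    by apply: integrableS intd.
  rewrite -Rintegral_itv_obnd_cbnd// [RHS](@Rintegral_affine _ p2 q2)//.
  rewrite itv_right gtr0_norm// -RintegralZl//; last first.
    by have := integrable_affine p2 q2_neq0 mr intdr; rewrite itv_right.
  apply: eq_Rintegral => s; rewrite inE/= in_itv/= => /andP[ths _].
  by rewrite /W /Gd /concat_control /concat_curve leNgt ths evZ.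
rewrite {1}/concat_curve; case: ifPn => [tth|].
  by rewrite hc ?left_int ?add0r//; rewrite -[q1 * t]add0r; exact: I01_left.
rewrite -ltNge => tht.
rewrite hd; last by apply: I01_right => //; exact: ltW.
rewrite hc// -right_int// -addrA; congr (_ + _).
have -> : \int[mu]_(s in I01) Gc s = \int[mu]_(s in `[0, th]) W s.
  by rewrite left_int ?q1th ?lexx//= in_itv/= !ltW.
rewrite -(@Rintegral_itvB R W (BLeft 0) (BRight t) th).
- by rewrite addrC subrK.
- apply: integrableS intW => // s; rewrite /= !in_itv/= => /andP[-> st].
  by move: It; rewrite /= in_itv/= => /andP[_]; exact: le_trans.
- by rewrite bnd_simp ltW.
- by rewrite bnd_simp ltW.
Qed.


End concatenation.

(** Outside [Omega] the fields vanish, so the embedding constant bounds them everywhere; on the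
    derivative it gives a global Lipschitz bound through [C10_lipschitz]. *)
Lemma admissible_bounds (R : realType) (N : nat) (Omega : set 'rV[R]_N)
    (H : completeNormedModType R) (dot : {dot H for idfun})
    (ev : {linear H -> ('rV[R]_N -> 'rV[R]_N)}) :
  open Omega -> admissible Omega dot ev ->
  exists K : R, [/\ 0 <= K, (forall h x, `|ev h x| <= K * `|h|) &
    (forall h x y, `|ev h x - ev h y| <= K * `|h| * `|x - y|)].
Proof.
move=> oO adm; have [C hC] := admissible_embedding adm.
have hC' h x y : Omega x -> Omega y ->
    `|ev h x| + `|jacobian (ev h) y| <= `|C| * `|h|.
  move=> Ox Oy; apply: (le_trans (hC h x y Ox Oy)).
  by rewrite ler_wpM2r// ler_norm.
have nC : 0 <= `|C| by [].
have N0 : 0 <= N%:R :> R by [].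
(* This dominates both [|C|], for the sup bound, and [2 * N * |C|], for the Lipschitz bound. The
   absolute value is taken because the sign of [C] is unknown. *)
exists (`|C| * (1 + 2 * N%:R)); split=> [|h x|h x y].
- by rewrite mulr_ge0// addr_ge0// mulr_ge0.
- apply: (@le_trans _ _ (`|C| * `|h|)); last first.
    by rewrite ler_wpM2r// ler_peMr// lerDl mulr_ge0.
  have [Ox|nOx] := pselect (Omega x).
    by apply: le_trans (hC' h x x Ox Ox); rewrite lerDl.
  by rewrite (C10_outside (admissible_C10 adm h) nOx) normr0 mulr_ge0.
- have Ch0 : 0 <= `|C| * `|h| by rewrite mulr_ge0.
  apply: (le_trans (@C10_lipschitz _ _ _ _ (`|C| * `|h|) x y oO
    (admissible_C10 adm h) Ch0 _)).
    by move=> z Oz; apply: le_trans (hC' h z z Oz Oz); rewrite lerDr.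
  rewrite ler_wpM2r// [leRHS](_ : _ = (1 + 2 * N%:R) * (`|C| * `|h|)); last by ring.
  by rewrite ler_wpM2r// lerDr.
Qed.

(** * The length function of the group *)

Lemma invmapE (R : realType) (N : nat) (g g' : 'rV[R]_N -> 'rV[R]_N) :
  cancel g g' -> cancel g' g -> invmap g = g'.
Proof.
move=> gK g'K; apply/funext => y; rewrite -{1}(g'K y).
rewrite /invmap pinvKV ?inE// => a b _ _ gab.
by rewrite -(gK a) gab gK.
Qed.

Section group_length.
Context {R : realType} {N : nat} {H : completeNormedModType R}.
Local Notation V := 'rV[R]_N.
Local Notation I01 := (`[0%R, 1%R]%classic : set R).
Local Notation mu := (@lebesgue_measure R).
Variables (ev : {linear H -> (V -> V)}) (K : R).
Hypothesis K_ge0 : 0 <= K.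
Hypothesis ev_le : forall h x, `|ev h x| <= K * `|h|.
Hypothesis ev_lip : forall h x y, `|ev h x - ev h y| <= K * `|h| * `|x - y|.
Local Notation G := (groupH ev).
Local Notation len := (fun g => distH ev g id).

(** Stated with an upper bound [r] rather than the exact norm, so that [r] can be enlarged and the
    infimum in [distH] approached from above. *)
Let reachable (g : V -> V) (r : R) := exists u phi,
  [/\ L2H u, is_flow ev u phi, g = phi 1 & L2H_norm u <= r].

Let I1 : I01 1. Proof. by rewrite /= in_itv/= lexx ler01. Qed.

Let reachable_ge0 g r : reachable g r -> 0 <= r.
Proof. by move=> [u [phi [_ _ _]]]; apply: le_trans; exact: L2H_norm_ge0. Qed.

Let reachable_le g r r' : r <= r' -> reachable g r -> reachable g r'.
Proof.
by move=> rr' [u [phi [? ? ? ur]]]; exists u, phi; split=> //; exact: le_trans rr'.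
Qed.

Let groupHP g : G g <-> exists r, reachable g r.
Proof.
split=> [[u [phi [Hu fu gE]]]|[r [u [phi [Hu fu gE _]]]]]; last by exists u, phi.
by exists (L2H_norm u), u, phi.
Qed.

Let reachable_id : reachable id 0.
Proof.
have s0 : simple_fun (fun=> 0 : H).
  split; first by apply: sub_finite_set (finite_set1 (0 : H)) => _ [t _ <-].
  by move=> h; rewrite preimage_cst; case: ifP => _; [exact: measurableT|exact: measurable0].
have [H0 n0] : L2H (fun=> 0 : H) /\ L2H_norm (fun=> 0 : H) <= 0.
  apply: L2H_norm_le => //.
    by exists (fun _ _ => 0); split=> // t _; exact: cvg_cst.
  by rewrite normr0 expr0n/= integral0.
exists (fun=> 0), (fun _ x => x); split=> // x; split.
  by apply: continuous_subspaceT => t; exact: cvg_cst.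
move=> t It i; rewrite linear0 /=.
under eq_Rintegral do rewrite mxE.
by rewrite Rintegral_cst// mul0r addr0.
Qed.

(** Positivity is asked of the bounds, not of the norms: it puts the splitting time strictly between
    0 and 1 even when a control is zero. *)
Let reachable_comp g h a b : 0 < a -> 0 < b ->
  reachable g a -> reachable h b -> reachable (h \o g) (a + b).
Proof.
move=> a0 b0 [u [phi [Hu fu -> ua]]] [v [psi [Hv fv -> vb]]].
pose th := a / (a + b).
have ab0 : 0 < a + b by exact: addr_gt0.
have th0 : 0 < th by exact: divr_gt0.
have th1 : th < 1 by rewrite ltr_pdivrMr// mul1r ltrDl.
have [Hw wab] := concat_control_L2H th0 th1 Hu Hv ua vb a0 b0 erefl.
exists (concat_control th u v).
exists (fun t x => concat_curve th (phi ^~ x) (psi ^~ (phi 1 x)) t); split=> //.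
  move=> x; exact: (concat_solution K_ge0 ev_le ev_lip th0 th1 Hu Hv Hw
    (fu x) (fv (phi 1 x))).
apply/funext => x; rewrite /concat_curve leNgt th1 /=; congr (psi _ _).
by field; rewrite gt_eqF// subr_gt0.
Qed.

Let reachable_inv g r : reachable g r ->
  exists g', [/\ cancel g g', cancel g' g & reachable g' r].
Proof.
move=> [u [phi [Hu fu -> ur]]].
have [Hv vu] := reverse_control_L2H Hu.
have [psi fv] := flow_exists K_ge0 ev_le ev_lip Hv.
exists (psi 1); split.
- exact: (reverse_flow_cancel K_ge0 ev_le ev_lip Hu fu fv).
- apply: (reverse_flow_cancel K_ge0 ev_le ev_lip Hv fv).
  by rewrite reverse_controlK.
- by exists (reverse_control u), psi; split=> //; exact: le_trans ur.
Qed.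

Let reachable_invmap g r : reachable g r -> reachable (invmap g) r.
Proof. by move=> /reachable_inv[g' [gK g'K]]; rewrite (invmapE gK g'K). Qed.

Lemma groupH_id : G id.
Proof. by apply/groupHP; exists 0. Qed.

Lemma groupH_comp g h : G g -> G h -> G (h \o g).
Proof.
(* Adding 1 makes both bounds positive. *)
move=> /groupHP[a ga] /groupHP[b hb]; apply/groupHP; exists (a + 1 + (b + 1)).
have a0 := reachable_ge0 ga; have b0 := reachable_ge0 hb.
apply: reachable_comp; rewrite ?ltr_wpDl//.
  by apply: reachable_le ga; rewrite lerDl.
by apply: reachable_le hb; rewrite lerDl.
Qed.

Lemma groupH_invmap g : G g -> G (invmap g).
Proof. by move=> /groupHP[r gr]; apply/groupHP; exists r; exact: reachable_invmap. Qed.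

Lemma invmapK g : G g -> cancel g (invmap g).
Proof.
by move=> /groupHP[r /reachable_inv[g' [gK g'K _]]]; rewrite (invmapE gK g'K).
Qed.

Lemma invmapVK g : G g -> cancel (invmap g) g.
Proof.
by move=> /groupHP[r /reachable_inv[g' [gK g'K _]]]; rewrite (invmapE gK g'K).
Qed.

Lemma invmap_comp g h : G g -> G h -> invmap (h \o g) = invmap g \o invmap h.
Proof.
move=> Gg Gh; apply: invmapE => x /=; first by rewrite (invmapK Gh) (invmapK Gg).
by rewrite (invmapVK Gg) (invmapVK Gh).
Qed.

Lemma distH_ge0 g h : 0 <= distH ev g h.
Proof.
rewrite /distH; set S := (X in inf X).
have [->|/set0P S0] := eqVneq S set0; first by rewrite inf0.
by apply: lb_le_inf => // r [u [phi [_ _ _ ->]]]; exact: L2H_norm_ge0.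
Qed.

(** [distH ev g id] asks for [id = g \o phi 1], that is, for a flow ending at the inverse of [g];
    time reversal provides one with the same bound. *)
Let len_le g r : reachable g r -> len g <= r.
Proof.
move=> gr; have [g' [gK g'K [u [phi [Hu fu g'E ur]]]]] := reachable_inv gr.
apply: le_trans ur; apply: ge_inf.
  by exists 0 => _ [v [psi [_ _ _ ->]]]; exact: L2H_norm_ge0.
exists u, phi; split=> //; rewrite -g'E.
by apply/funext => x /=; rewrite g'K.
Qed.

(** A control within [e] of the infimum generates the inverse of [g], and its reversal reaches
    [g]. *)
Let reachable_len g e : G g -> 0 < e -> reachable g (len g + e).
Proof.
move=> Gg e0; have /groupHP[r0 gr0] := Gg.
have [g' [gK g'K [u0 [phi0 [Hu0 fu0 g'E _]]]]] := reachable_inv gr0.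
have [|r [u [phi [Hu fu gphi ->]]] rlt] := @inf_adherent R
    [set r | exists u phi, [/\ L2H u, is_flow ev u phi, id = g \o phi 1 & r = L2H_norm u]] e e0.
  split; last by exists 0 => _ [v [psi [_ _ _ ->]]]; exact: L2H_norm_ge0.
  exists (L2H_norm u0), u0, phi0; split=> //; rewrite -g'E.
  by apply/funext => x /=; rewrite g'K.
have ru : reachable (phi 1) (len g + e) by exists u, phi; split=> //; exact: ltW.
have [psi [phiK psiK]] := reachable_inv ru.
suff -> : g = psi by [].
apply/funext => x; rewrite -{1}(psiK x).
by have := congr1 (fun f => f (psi x)) gphi => /= <-.
Qed.

Lemma len_id : len id = 0.
Proof. by apply/eqP; rewrite eq_le distH_ge0 andbT; exact: len_le. Qed.

Lemma len_invmap g : G g -> len (invmap g) <= len g.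
Proof.
move=> Gg; apply/ler_addgt0Pr => e e0; apply: len_le.
by apply: reachable_invmap; exact: reachable_len.
Qed.

(** Each factor receives a slack [e / 2], which also makes the two bounds positive as
    [reachable_comp] requires. *)
Lemma len_comp g h : G g -> G h -> len (h \o g) <= len h + len g.
Proof.
move=> Gg Gh; apply/ler_addgt0Pr => e e0; apply: len_le.
have e2 : 0 < e / 2 by exact: divr_gt0.
have -> : len h + len g + e = (len g + e / 2) + (len h + e / 2) by field.
by apply: reachable_comp; rewrite ?ltr_wpDl ?distH_ge0//; exact: reachable_len.
Qed.

End group_length.

(** * The multiscale iteration *)

(** The limsup is an infimum of suprema over neighbourhoods of infinity, so one of these suprema is
    below [+oo]; it is not [-oo] since it dominates a real number. *)
Lemma limn_esup_lty_bounded (R : realType) (x : R^nat) :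
  (limn_esup (fun n => (x n)%:E) < +oo)%E ->
  exists M n0, forall n, (n0 <= n)%N -> x n <= M.
Proof.
move=> /ereal_inf_lt[_ [A [n0 _ n0A] <-]].
set S := ereal_sup _ => Sy.
have xS n : (n0 <= n)%N -> ((x n)%:E <= S)%E.
  by move=> nn; apply: ereal_sup_ubound; exists n => //; exact: n0A.
case: S Sy xS => [M _ xM| //|_ xM].
  by exists M, n0 => n /xM; rewrite lee_fin.
by have := xM n0 (leqnn _).
Qed.

(* [W n = T n / 2 ^+ n] is nonincreasing, tends to 0 geometrically, and yet
   [W n `^ beta >= c]. *)
Lemma doubling_growth_contradiction (R : realType) (beta c : R) (T l : nat -> R) :
  0 < beta -> 0 < c -> (forall n, 0 <= T n) -> (forall n, 0 <= l n) ->
  (forall n, T n.+1 = T n + l n) ->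
  (forall n, l n `^ beta + c * (2 ^+ n) `^ beta <= T n `^ beta) -> False.
Proof.
move=> b0 c0 T0 l0 TS lT.
pose W n := T n / 2 ^+ n.
have p2 n : 0 < 2 ^+ n :> R by exact: exprn_gt0.
have W0 n : 0 <= W n by rewrite divr_ge0// ltW.
have TW n : T n = W n * 2 ^+ n by rewrite /W divfK// gt_eqF.
pose m n := l n / 2 ^+ n.
have m0 n : 0 <= m n by rewrite divr_ge0// ltW.
have lm n : l n = m n * 2 ^+ n by rewrite /m divfK// gt_eqF.
have WS n : W n.+1 = (W n + m n) / 2.
  by rewrite /W /m TS exprS invfM; field; rewrite gt_eqF.
have mW n : m n `^ beta + c <= W n `^ beta.
  have := lT n; rewrite TW lm !powRM ?(ltW (p2 n))// -mulrDl.
  by rewrite ler_pM2r// powR_gt0.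
(* [m n > W n] would contradict [mW]; thus [T] at most doubles. *)
have WW n : W n.+1 <= W n.
  rewrite WS ler_pdivrMr// mulr_natr mulr2n lerD2l leNgt; apply/negP => Wm.
  have := mW n; apply/negP; rewrite -ltNge (@lt_le_trans _ _ (m n `^ beta + 0))//.
    by rewrite addr0 gt0_ltr_powR ?nnegrE.
  by rewrite lerD2l ltW.
have W0n n : W n <= W 0%N.
  by elim: n => [|n IH]; [exact: lexx|exact: le_trans (WW n) IH].
(* Since [W n <= W 0], the constant [c] is at least the fraction [rho] of every [W n] raised to the
   power [beta]. *)
pose rho := c / W 0%N `^ beta.
have W0b : c <= W 0%N `^ beta.
  by apply: le_trans (mW 0%N); rewrite lerDr powR_ge0.
have W0p : 0 < W 0%N `^ beta by exact: lt_le_trans W0b.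
have rho0 : 0 < rho by exact: divr_gt0.
have rho1 : 0 <= 1 - rho by rewrite subr_ge0 ler_pdivrMr// mul1r.
have mle n : m n `^ beta <= (1 - rho) * W n `^ beta.
  rewrite mulrBl mul1r lerBrDr; apply: le_trans (mW n); rewrite lerD2l.
  rewrite /rho mulrAC ler_pdivrMr// ler_pM2l// ge0_ler_powR ?nnegrE//.
  exact: ltW.
pose theta := (1 - rho) `^ beta^-1.
have bn0 : beta != 0 by rewrite gt_eqF.
have theta1 : theta < 1.
  have <- : 1 `^ beta^-1 = 1 :> R by rewrite powR1.
  apply: gt0_ltr_powR; rewrite ?invr_gt0 ?nnegrE//.
  by rewrite gtrBl.
have theta0 : 0 <= theta by exact: powR_ge0.
have mth n : m n <= theta * W n.
  rewrite leNgt; apply/negP => h; have := mle n; apply/negP; rewrite -ltNge.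
  have -> : (1 - rho) * W n `^ beta = (theta * W n) `^ beta.
    by rewrite powRM// /theta -powRrM mulVf// powRr1.
  by rewrite gt0_ltr_powR ?nnegrE ?mulr_ge0.
(* [m n <= theta * W n] gives [W n.+1 <= q * W n], so [T] grows by a factor at most
   [1 + theta < 2]. *)
pose q := (1 + theta) / 2.
have q0 : 0 <= q by rewrite /q; lra.
have q1 : q < 1 by rewrite /q; lra.
have Wq n : W n <= W 0%N * q ^+ n.
  elim: n => [|n IH]; first by rewrite expr0 mulr1.
  have h : W n.+1 <= q * W n by rewrite WS /q; have := mth n; lra.
  by apply: (le_trans h); rewrite exprS [leRHS]mulrCA ler_wpM2l.
have cW n : c `^ beta^-1 <= W n.
  have h : c <= W n `^ beta by apply: le_trans (mW n); rewrite lerDr powR_ge0.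
  have -> : W n = (W n `^ beta) `^ beta^-1 by rewrite -powRrM mulfV// powRr1.
  by rewrite ge0_ler_powR ?nnegrE ?powR_ge0 ?invr_ge0// ltW.
have cv : W 0%N * q ^+ n @[n --> \oo] --> (0 : R).
  by apply: cvg_geometric; rewrite ger0_norm.
have : c `^ beta^-1 <= 0.
  rewrite -(cvg_lim _ cv)//; apply: limr_ge; first by apply/cvg_ex; exists 0.
  by apply: nearW => n; apply: le_trans (cW n) (Wq n).
by rewrite leNgt powR_gt0.
Qed.

(** * Convergence of the iterates to the infimal mismatch *)

Lemma L2norm_ge0 (R : realType) (N : nat) (Omega : set 'rV[R]_N) (f : 'rV[R]_N -> R) :
  0 <= L2norm Omega f.
Proof. by rewrite /L2norm fine_ge0// Lnorm_ge0. Qed.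

Theorem theorem2p12 (R : realType) (N : nat) (Omega : set 'rV[R]_N)
    (H : completeNormedModType R) (dot : {dot H for idfun})
    (ev : {linear H -> ('rV[R]_N -> 'rV[R]_N)})
    (I0 I1 : 'rV[R]_N -> R) (alpha beta gamma : R) (lambda a : nat -> R)
    (g : nat -> 'rV[R]_N -> 'rV[R]_N) :
  (1 <= N)%N -> open Omega -> admissible Omega dot ev ->
  inL2 Omega I0 -> inL2 Omega I1 ->
  0 < alpha -> 0 < beta -> 0 < gamma ->
  (forall n, 0 < lambda n) -> (forall n, 0 <= a n) ->
  (forall n, a n.+1 <= a n) -> a n @[n --> \oo] --> 0 ->
  (limn_esup (fun n => (2 `^ (beta * n%:R) / lambda n)%:E) < +oo)%E ->
  minimizer_over (groupH ev)
    (fun h =>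
       lambda 0%N * (L2norm Omega ((I0 \o invmap h) \- I1) `^ alpha
                     + a 0%N * distH ev h id `^ gamma)
       + distH ev h id `^ beta) (g 0%N) ->
  (forall n, minimizer_over (groupH ev)
    (fun h =>
       lambda n.+1 *
         (L2norm Omega ((I0 \o invmap (composed g n) \o invmap h) \- I1) `^ alpha
          + a n.+1 * distH ev (h \o composed g n) id `^ gamma)
       + distH ev h id `^ beta) (g n.+1)) ->
  let delta0 := inf [set L2norm Omega ((I0 \o invmap h) \- I1)
                    | h in groupH ev] in
  let eps := fun n =>
    (L2norm Omega ((I0 \o invmap (composed g n)) \- I1) `^ alpha
     + a n * distH ev (composed g n) id `^ gamma) `^ alpha^-1 in
  let eps0 := limn eps in
  [/\ cvgn eps, eps0 = delta0 &
      L2norm Omega ((I0 \o invmap (composed g n)) \- I1) @[n --> \oo]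
        --> delta0].
Proof.
move=> _ oO adm _ _ a0 b0 g0 lam0 an0 aS acvg lamsup min0 minS delta0 eps eps0.
have [K [K0 evle evlip]] := admissible_bounds oO adm.
pose len h := distH ev h id.
have len_ge0 h : 0 <= len h by exact: distH_ge0.
have lenid : len id = 0 by exact: (len_id K0 evle evlip).
have lencomp p q : groupH ev p -> groupH ev q -> len (q \o p) <= len q + len p.
  exact: (len_comp K0 evle evlip).
have leninv p : groupH ev p -> len (invmap p) <= len p.
  exact: (len_invmap K0 evle evlip).
have Gid : groupH ev id by exact: groupH_id.
have Gcomp p q : groupH ev p -> groupH ev q -> groupH ev (q \o p).
  exact: (groupH_comp K0 evle evlip).
have Ginv p : groupH ev p -> groupH ev (invmap p).
  exact: (groupH_invmap K0 evle evlip).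
have Gg n : groupH ev (g n) by case: n => [|n]; [case: min0|case: (minS n)].
have Gc n : groupH ev (composed g n).
  by elim: n => [|n IH] /=; [exact: Gg|exact: Gcomp].
pose mism h := L2norm Omega ((I0 \o invmap h) \- I1).
have mism0 h : 0 <= mism h by exact: L2norm_ge0.
pose J b h := mism h `^ alpha + b * len h `^ gamma.
have J0 n h : 0 <= J (a n) h by rewrite addr_ge0 ?powR_ge0// mulr_ge0 ?powR_ge0.
pose F n := J (a n) (composed g n).
(* The competitor is [p \o invmap (composed g n)], whose composition with [composed g n] is [p]. *)
have minJ n p : groupH ev p ->
    lambda n.+1 * F n.+1 + len (g n.+1) `^ beta <=
    lambda n.+1 * J (a n.+1) p + len (p \o invmap (composed g n)) `^ beta.
  move=> Gp; have Gk : groupH ev (p \o invmap (composed g n)) by apply: Gcomp => //; exact: Ginv.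
  have comp k : groupH ev k ->
      (I0 \o invmap (composed g n) \o invmap k) = I0 \o invmap (k \o composed g n).
    by move=> Gk'; rewrite (invmap_comp K0 evle evlip)//.
  have [_ /(_ _ Gk)] := minS n; rewrite !comp//.
  rewrite (_ : p \o invmap (composed g n) \o composed g n = p)//.
  by apply/funext => x /=; rewrite (invmapK K0 evle evlip).
(* Here [p] is [composed g n], so the competitor is the identity, of length zero; then
   [a n.+1 <= a n] is used. *)
have FS n : F n.+1 <= F n.
  have := minJ n _ (Gc n).
  rewrite (_ : _ \o invmap _ = id); last first.
    by apply/funext => x /=; rewrite (invmapVK K0 evle evlip).
  rewrite lenid powR0 ?gt_eqF// addr0 => h.
  apply: (@le_trans _ _ (J (a n.+1) (composed g n))); last first.
    by rewrite lerD2l ler_wpM2r ?powR_ge0.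
  rewrite -(ler_pM2l (lam0 n.+1)); apply: le_trans h.
  by rewrite lerDl powR_ge0.
have ai0 : 0 < alpha^-1 by rewrite invr_gt0.
have powK x : 0 <= x -> (x `^ alpha) `^ alpha^-1 = x.
  by move=> x0; rewrite -powRrM mulfV ?gt_eqF// powRr1.
have powVK x : 0 <= x -> (x `^ alpha^-1) `^ alpha = x.
  by move=> x0; rewrite -powRrM mulVf ?gt_eqF// powRr1.
have epsE n : eps n = F n `^ alpha^-1 by [].
have eps_ge0 n : 0 <= eps n by exact: powR_ge0.
have eps_decr : {homo eps : n m / (n <= m)%N >-> m <= n}.
  apply/nonincreasing_seqP => n; rewrite !epsE ge0_ler_powR ?nnegrE ?J0//.
  exact: ltW.
have cveps : cvgn eps.
  by apply: nonincreasing_is_cvgn => //; exists 0 => _ [n _ <-].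
have eps0_le n : eps0 <= eps n by exact: nonincreasing_cvgn_ge.
have eps0_ge0 : 0 <= eps0 by apply: limr_ge => //; exact: nearW.
have mism_eps n : mism (composed g n) <= eps n.
  rewrite -[leLHS]powK// epsE ge0_ler_powR ?nnegrE ?powR_ge0 ?J0//; first exact: ltW.
  by rewrite lerDl mulr_ge0// powR_ge0.
have lbm : has_lbound [set mism h | h in groupH ev] by exists 0 => _ [h _ <-].
have delta_mism n : delta0 <= mism (composed g n) by apply: ge_inf => //; exists (composed g n).
have delta_eps0 : delta0 <= eps0.
  by apply: limr_ge => //; apply: nearW => n; exact: le_trans (mism_eps n).
suff eps_delta : eps0 = delta0.
  split=> //; apply: (@squeeze_cvgr _ _ _ _ (fun=> delta0) eps).
  - by apply: nearW => n; rewrite delta_mism mism_eps.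
  - exact: cvg_cst.
  - by rewrite -eps_delta; exact: cveps.
apply/eqP; rewrite eq_le delta_eps0 andbT leNgt; apply/negP => lt_eps.
have [_ [p Gp <-] mp] : exists2 r, [set mism h | h in groupH ev] r & r < eps0.
  have hi : has_inf [set mism h | h in groupH ev].
    by split=> //; exists (mism id); exists id.
  have e0 : 0 < eps0 - delta0 by rewrite subr_gt0.
  have [r Sr rlt] := inf_adherent e0 hi.
  by exists r => //; rewrite -[eps0](subrKC delta0).
(* Half of the gap: the penalty [a n * len p ^ gamma] eventually fits into one half, and the other
   half remains as the gain. *)
pose eta := (eps0 `^ alpha - mism p `^ alpha) / 2.
have eta0 : 0 < eta.
  by rewrite divr_gt0// subr_gt0 gt0_ltr_powR// ?nnegrE.
have FE n : eps0 `^ alpha <= F n.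
  rewrite -[leRHS]powVK ?J0// -epsE ge0_ler_powR ?nnegrE//; exact: ltW.
have [n1 hn1] : exists n1, forall n, (n1 <= n)%N -> a n * len p `^ gamma <= eta.
  have c0 : a n * len p `^ gamma @[n --> \oo] --> (0 : R).
    by rewrite -[X in _ --> X](mul0r (len p `^ gamma)); apply: cvgMl.
  have /cvgrPdist_le /(_ eta eta0) [n1 _ hn1] := c0.
  exists n1 => n nn; have := hn1 n nn; rewrite /= sub0r normrN.
  by apply: le_trans; exact: ler_norm.
have [M [n2 hn2]] := limn_esup_lty_bounded lamsup.
pose n0 := maxn n1 n2.
have M0 : 0 < M.
  by apply: lt_le_trans (hn2 n2 (leqnn _)); rewrite divr_gt0 ?powR_gt0.
(* An upper bound for the length of the competitor, whose increments are exactly the lengths of the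
   next minimizers. *)
pose T n := len p + \sum_(k < n.+1) len (g k).
have T0 n : 0 <= T n by rewrite addr_ge0// sumr_ge0.
have lenc n : len (composed g n) <= \sum_(k < n.+1) len (g k).
  elim: n => [|n IH]; first by rewrite big_ord1.
  rewrite big_ord_recr/= addrC; apply: le_trans (lencomp _ _ (Gc n) (Gg n.+1)) _.
  by rewrite lerD2l.
have lenT n : len (p \o invmap (composed g n)) <= T n.
  apply: le_trans (lencomp _ _ (Ginv _ (Gc n)) Gp) _; rewrite lerD2l.
  exact: le_trans (leninv _ (Gc n)) (lenc n).
have growth n : (n0 <= n)%N ->
    len (g n.+1) `^ beta + eta * lambda n.+1 <= T n `^ beta.
  rewrite geq_max => /andP[nn1 nn2].
  have h1 : J (a n.+1) p + eta <= F n.+1.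
    apply: le_trans (FE n.+1).
    have := hn1 n.+1 (leq_trans nn1 (leqnSn _)); rewrite /J /eta; lra.
  have h2 : len (p \o invmap (composed g n)) `^ beta <= T n `^ beta.
    by rewrite ge0_ler_powR ?nnegrE//; exact: ltW.
  have h3 := ler_wpM2l (ltW (lam0 n.+1)) h1.
  have := minJ n p Gp; move: h3; rewrite mulrDr mulrC; lra.
have lamM n : (n2 <= n)%N -> 2 `^ (beta * n%:R) / M <= lambda n.
  by move=> /hn2; rewrite ler_pdivrMr// ler_pdivrMr// [M * _]mulrC.
(* The sequences are shifted by [n0], after which both the penalty and the limsup bounds hold. The
   constant [eta / M] combines the gain with [lambda n >= 2 ^ (beta n) / M]. *)
apply: (@doubling_growth_contradiction R beta (eta / M) (fun n => T (n0 + n)%N)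
  (fun n => len (g (n0 + n).+1))) => //.
- by rewrite divr_gt0.
- by move=> n; rewrite addnS /T big_ord_recr/= addrA.
- move=> n; apply: le_trans (growth (n0 + n)%N (leq_addr _ _)); rewrite lerD2l.
  rewrite -mulrA ler_pM2l//.
  apply: le_trans (lamM (n0 + n).+1 _); last first.
    by rewrite (leq_trans (leq_maxr n1 n2))// -addnS leq_addr.
  (* The available exponent [n0 + n + 1] is only larger than the required [n]. *)
  rewrite mulrC ler_pM2r ?invr_gt0// [beta * _]mulrC powRrM powR_mulrn//.
  rewrite ge0_ler_powR ?nnegrE ?exprn_ge0//; first exact: ltW.
  by rewrite ler_weXn2l ?ler1n// (leq_trans (leq_addl n0 n)).
Qed.
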